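(* Let $n \geq 3$ be an odd integer and $q = 3^n$. Then $|\mathrm{Solv}(\mathrm{PSL}(2, q))| = \frac{4q^2 - q + 1}{2}$.
   Context: For a finite group $G$ and $x \in G$, the solvabilizer of $x$ in $G$ is $\mathrm{Sol}_G(x) = \{y \in G : \langle x, y \rangle \text{ is solvable}\}$. $\mathrm{Solv}(G) = \{\mathrm{Sol}_G(x) : x \in G\}$ is the set of distinct solvabilizers of elements of $G$, and $|\mathrm{Solv}(G)|$ is its cardinality. *)

(* Defs.v *)
From mathcomp Require Import all_boot all_algebra all_fingroup all_solvable.
Set Implicit Arguments. Unset Strict Implicit. Unset Printing Implicit Defensive.
Import GRing.Theory.
Local Open Scope group_scope.

Definition Sol (gT : finGroupType) (G : {set gT}) (x : gT) : {set gT} :=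
  [set y in G | solvable <<[set x; y]>>].
Definition Solv (gT : finGroupType) (G : {set gT}) : {set {set gT}} :=
  [set Sol G x | x in G].

Definition SL2 (F : finFieldType) : {set {'GL_2[F]}} :=
  [set g : {'GL_2[F]} | (\det (val g) == 1)%R].

Lemma SL2_group_set (F : finFieldType) : group_set (SL2 F).
Proof.
apply/group_setP; split; first by rewrite inE /= det1.
move=> x y; rewrite !inE /= det_mulmx => /eqP -> /eqP ->.
by rewrite mulr1.
Qed.
Canonical SL2_group (F : finFieldType) := Group (SL2_group_set F).

Definition PSL2 (F : finFieldType) := (SL2 F / 'Z(SL2 F))%g.

(* Main.v *)
(** Modulo the centre, solvability of <x, y> can be tested in SL(2, q).  If a
    subgroup H of SL(2, q) is solvable and not central, the last noncentral term
    V of its derived series has all its elements commuting up to sign.  Either V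
    is commutative and H normalises the line spanned by the traceless part of an
    element of V, or V contains an anticommuting pair and H acts on a quaternion
    group, which forces all traces of H to lie in F_3.  Hence for y = al + be M
    with M traceless, M^2 = 1 or -1, and al, be nonzero, the group <x, y> is
    solvable iff det [x, M] = 0 or x M = - M x, so that Sol(y) only depends on M
    up to sign; here det [x, M] is a Gram determinant on the quadratic space of
    traceless matrices.

    Every noncentral element is, up to sign, an involution X (X^2 = -1), a
    regular element of a nonsplit (M^2 = -1) or split (M^2 = 1) torus, or a
    unipotent 1 + N (N^2 = 0).  Probing a solvabilizer with the split regular
    elements recovers its type, and the matrix up to sign in the split and
    involution cases.  For unipotents it only recovers the line of N, and N up to
    sign is found from the subgroups SL(2, 3): if y^2 = -1, then <1 + N, y> is
    solvable iff tr(y N)^2 = 1.  As the quadric u^2 + v w = c has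
    q (q - 1) + q #{u | u^2 = c} points, the classes number
    1 + 2 q(q-1)/2 + q(q+1)/2 + (q^2-1)/2. *)

Require Import Defs.
From mathcomp Require Import all_boot all_algebra all_fingroup all_solvable.
From mathcomp Require Import finfield ring zify.
Set Implicit Arguments. Unset Strict Implicit. Unset Printing Implicit Defensive.
Import GRing.Theory.

(** * Two-by-two matrices *)

Section TwoByTwo.
Local Open Scope ring_scope.
Variable F : fieldType.
Implicit Types (A B K M N X Y Z u v w x y : 'M[F]_2) (a b c d s t : F).

(** Lets [ring] use a known equation: what remains is an identity between differences. *)
Lemma eq_of_sub (V : zmodType) (p q r l : V) : r = l -> p - q = r - l -> p = q.
Proof. by move=> ->; rewrite subrr => /eqP; rewrite subr_eq0 => /eqP. Qed.

Definition mx2 a b c d : 'M[F]_2 :=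
  \matrix_(i, j) (if i == 0 then if j == 0 then a else b
                  else if j == 0 then c else d).

Lemma mx2_eta A : A = mx2 (A 0 0) (A 0 1) (A 1 0) (A 1 1).
Proof.
apply/matrixP=> i j; rewrite mxE.
by case: i j => [[|[|i]] Hi] [[|[|j]] Hj] //=; congr (A _ _); apply: val_inj.
Qed.

Lemma mx2_inj a b c d a' b' c' d' : mx2 a b c d = mx2 a' b' c' d' ->
  [/\ a = a', b = b', c = c' & d = d'].
Proof.
move/matrixP=> e; split.
- by have:= e 0 0; rewrite !mxE.
- by have:= e 0 1; rewrite !mxE.
- by have:= e 1 0; rewrite !mxE.
- by have:= e 1 1; rewrite !mxE.
Qed.

Lemma mx2D a b c d a' b' c' d' :
  mx2 a b c d + mx2 a' b' c' d' = mx2 (a + a') (b + b') (c + c') (d + d').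
Proof. by apply/matrixP=> i j; rewrite !mxE; do 2!case: ifP. Qed.

Lemma mx2N a b c d : - mx2 a b c d = mx2 (- a) (- b) (- c) (- d).
Proof. by apply/matrixP=> i j; rewrite !mxE; do 2!case: ifP. Qed.

Lemma mx2Z t a b c d : t *: mx2 a b c d = mx2 (t * a) (t * b) (t * c) (t * d).
Proof. by apply/matrixP=> i j; rewrite !mxE; do 2!case: ifP. Qed.

Lemma mx2M a b c d a' b' c' d' : mx2 a b c d * mx2 a' b' c' d' =
  mx2 (a * a' + b * c') (a * b' + b * d') (c * a' + d * c') (c * b' + d * d').
Proof.
apply/matrixP=> i j; rewrite -mulmxE !mxE !big_ord_recl big_ord0 !mxE /= addr0.
by do 2!case: ifP.
Qed.

Lemma mx2_scalar t : t%:M = mx2 t 0 0 t.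
Proof.
by apply/matrixP=> -[[|[|i]] Hi] [[|[|j]] Hj] //; rewrite !mxE.
Qed.

Lemma mx2_0 : 0 = mx2 0 0 0 0.
Proof. by apply/matrixP=> i j; rewrite !mxE; do 2!case: ifP. Qed.

Lemma mx2_1 : 1 = mx2 1 0 0 1.
Proof. by rewrite -mx2_scalar. Qed.

Lemma mx2_tr a b c d : \tr (mx2 a b c d) = a + d.
Proof. by rewrite /mxtrace !big_ord_recl big_ord0 !mxE /= addr0. Qed.

Lemma mx2_det a b c d : \det (mx2 a b c d) = a * d - b * c.
Proof.
rewrite (expand_det_row _ 0) !big_ord_recl big_ord0 /cofactor !det_mx11 !mxE /=.
by rewrite /bump /=; ring.
Qed.

Definition mx2E := (mx2_scalar, mx2_0, mx2_1, mx2M, mx2D, mx2N, mx2Z,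
                    mx2_tr, mx2_det).

Lemma tr0_mx2 X : \tr X = 0 -> exists a b c, X = mx2 a b c (- a).
Proof.
rewrite [X]mx2_eta mx2_tr => /eqP; rewrite addrC addr_eq0 => /eqP ->.
by do 3!eexists.
Qed.

(** Polarised Cayley-Hamilton. Thus [\tr (X * Y)] is the bilinear form of the space of traceless
    matrices, and orthogonality amounts to anticommutation. *)
Lemma tr0_anticomm X Y : \tr X = 0 -> \tr Y = 0 ->
  X * Y + Y * X = (\tr (X * Y))%:M.
Proof.
move=> /tr0_mx2[a [b [c ->]]] /tr0_mx2[a' [b' [c' ->]]].
by rewrite !mx2E; congr mx2; ring.
Qed.

Lemma tr0_sqr X : \tr X = 0 -> X * X = (- \det X)%:M.
Proof. by move=> /tr0_mx2[a [b [c ->]]]; rewrite !mx2E; congr mx2; ring. Qed.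

Lemma mx2_tr_sqr X : \tr (X * X) = (\tr X) ^+ 2 - \det X *+ 2.
Proof. by rewrite [X]mx2_eta !mx2E; ring. Qed.

Lemma mx2_tr_cube X :
  \tr (X * X * X) = (\tr X) ^+ 3 - (\det X * \tr X) *+ 3.
Proof. by rewrite [X]mx2_eta !mx2E; ring. Qed.

(** The right-hand side is the Gram determinant for the trace form, as
    [\tr (X * X) = - 2 \det X]. *)
Lemma det_commutator_tr0 X Y : \tr X = 0 -> \tr Y = 0 ->
  \det (X * Y - Y * X) = (\det X * \det Y) *+ 4 - (\tr (X * Y)) ^+ 2.
Proof.
move=> /tr0_mx2[a [b [c ->]]] /tr0_mx2[a' [b' [c' ->]]].
by rewrite !mx2E; ring.
Qed.

Lemma unip_mulV (N : 'M[F]_2) : N * N = 0 -> (1 + N) * (1 - N) = 1.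
Proof. by move=> NN; rewrite mulrDl !mulrBr !mulr1 mul1r NN subr0 subrK. Qed.

Lemma tr_mul_conj_unip A N : \tr A = 0 -> \tr N = 0 ->
  \tr (A * ((1 - N) * (A * (1 + N)))) =
  - (\det A *+ 2 + (\tr (A * N)) ^+ 2 - (\det A * \det N) *+ 2).
Proof.
move=> /tr0_mx2[a [b [c ->]]] /tr0_mx2[a' [b' [c' ->]]].
by rewrite !mx2E; ring.
Qed.

(** Commutation makes the triples (upper right, lower left, diagonal difference) of [u] and [v]
    proportional; [t] is the ratio at a nonzero coordinate of the triple of [v]. *)
Lemma mx2_comm u v : u * v = v * u -> ~~ is_scalar_mx v ->
  exists s t, u = s%:M + t *: v.
Proof.
rewrite [u]mx2_eta [v]mx2_eta.
move: (u 0 0) (u 0 1) (u 1 0) (u 1 1) => a b c d.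
move: (v 0 0) (v 0 1) (v 1 0) (v 1 1) => a' b' c' d'.
rewrite !mx2M => /mx2_inj[e1 e2 e3 e4] nsv.
have E2 : b * (a' - d') = b' * (a - d).
  by apply: (eq_of_sub (esym e2)); ring.
have E3 : c * (a' - d') = c' * (a - d).
  by apply: (eq_of_sub e3); ring.
have E1 : b * c' = b' * c.
  by apply: (eq_of_sub e1); ring.
have [b0|b0] := eqVneq b' 0; last first.
  exists (a - b / b' * a'), (b / b').
  rewrite !mx2E; congr mx2; first by ring.
  - by field.
  - by rewrite add0r mulrAC E1 mulrC mulKf.
  - have ->: d = a - b / b' * (a' - d') by rewrite mulrAC E2 mulrAC divff // mul1r; ring.
    by ring.
have [c0|c0] := eqVneq c' 0; last first.
  exists (a - c / c' * a'), (c / c').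
  rewrite !mx2E; congr mx2; first by ring.
  - by rewrite add0r mulrAC [c * b']mulrC -E1 mulfK.
  - by field.
  - have ->: d = a - c / c' * (a' - d') by rewrite mulrAC E3 mulrAC divff // mul1r; ring.
    by ring.
have [ad|ad] := eqVneq a' d'.
  case/negP: nsv; rewrite b0 c0 ad -mx2_scalar; exact: scalar_mx_is_scalar.
have ad' : a' - d' != 0 by rewrite subr_eq0.
exists (a - (a - d) / (a' - d') * a'), ((a - d) / (a' - d')).
have b00 : b = 0 by apply: (mulIf ad'); rewrite E2 b0 !mul0r.
have c00 : c = 0 by apply: (mulIf ad'); rewrite E3 c0 !mul0r.
by rewrite !mx2E b0 c0 b00 c00; congr mx2; field.
Qed.

End TwoByTwo.

(** * Anticommuting and nilpotent matrices in characteristic three *)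

Section CharThree.
Local Open Scope ring_scope.
Variable F : fieldType.
Hypothesis char3 : 3%:R = 0 :> F.
Hypothesis nsqN1 : forall a : F, a ^+ 2 != -1.
Implicit Types (A B K M N X Y Z u v w x y : 'M[F]_2) (a b c d s t : F).

(** The witness [e] is the cofactor of 3, leaving an identity that [ring] can check. *)
Lemma eq_mod3 (a b e : F) : a - b = 3%:R * e -> a = b.
Proof. by rewrite char3 mul0r => /eqP; rewrite subr_eq0 => /eqP. Qed.

Lemma two_neq0 : 2%:R != 0 :> F.
Proof.
apply: contraNneq (oner_neq0 F) => h2.
by rewrite -(addr0 1) -h2 -mulrS char3 h2.
Qed.

Lemma addrr_eq0 a : (a + a == 0) = (a == 0).
Proof. by rewrite -mulr2n -mulr_natl mulf_eq0 (negPf two_neq0). Qed.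

Lemma mx_addrr_eq0 A : A + A = 0 -> A = 0.
Proof.
move=> e; have/eqP: 2%:R *: A = 0 by rewrite scaler_nat mulr2n.
by rewrite scaler_eq0 (negPf two_neq0) => /eqP.
Qed.

Lemma scalarMl s A : s%:M * A = s *: A. Proof. exact: mul_scalar_mx. Qed.
Lemma scalarMr s A : A * s%:M = s *: A. Proof. exact: mul_mx_scalar. Qed.

Lemma tr0_scalar X : \tr X = 0 -> is_scalar_mx X -> X = 0.
Proof.
move=> trX /is_scalar_mxP[a eX]; move: trX; rewrite eX mxtrace_scalar mulr2n.
by move/eqP; rewrite addrr_eq0 => /eqP ->; rewrite raddf0.
Qed.

Lemma tr0_nonscalar X : \tr X = 0 -> X != 0 -> ~~ is_scalar_mx X.
Proof. by move=> trX; apply: contraNN => sX; apply/eqP/tr0_scalar. Qed.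

Lemma det_neq0 A : \det A != 0 -> A != 0.
Proof. by apply: contraNneq => ->; rewrite det0. Qed.

Lemma mx2_mulI A B C : \det A != 0 -> A * B = A * C -> B = C.
Proof.
move=> dA e; have uA : A \in unitmx by rewrite unitmxE unitfE.
by rewrite -[B](mulKmx uA) -[C](mulKmx uA); congr (_ *m _).
Qed.

(** [w] is invertible, so [v] is conjugate to [- v]. *)
Lemma anti_tr0 v w : v * w = - (w * v) -> \det w != 0 -> \tr v = 0.
Proof.
move=> e dw; have uw : w \in unitmx by rewrite unitmxE unitfE.
have /eqP: \tr v = - \tr v.
  rewrite -{1}[v](mulmxK uw) mxtrace_mulC mulmxE e mulrN.
  by rewrite -[X in X * _]/(invmx w) -!mulmxE mulKmx // raddfN.
by rewrite -subr_eq0 opprK addrr_eq0 => /eqP.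
Qed.

Lemma anti_sym v w : v * w = - (w * v) -> w * v = - (v * w).
Proof. by move->; rewrite opprK. Qed.

Lemma anti_nonscalar v w : v * w = - (w * v) -> \det v != 0 -> \det w != 0 ->
  ~~ is_scalar_mx v.
Proof.
by move=> e dv dw; rewrite tr0_nonscalar ?det_neq0 // (anti_tr0 e).
Qed.

Lemma comm_tr0 X Y : X * Y = Y * X -> \tr X = 0 -> \tr Y = 0 -> Y != 0 ->
  exists t, X = t *: Y.
Proof.
move=> e tX tY nY; have [s [t eX]] := mx2_comm e (tr0_nonscalar tY nY).
exists t; rewrite eX; move: tX; rewrite eX raddfD /= linearZ /= tY mulr0 addr0.
by rewrite mxtrace_scalar mulr2n => /eqP; rewrite addrr_eq0 => /eqP->;
   rewrite raddf0 add0r.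
Qed.

(** Commuting with [v] puts [u] in [F[v]]; commuting with [w] then kills the component along [v],
    whose sign [w] reverses. *)
Lemma comm_anti_pair v w u : v * w = - (w * v) -> \det v != 0 -> \det w != 0 ->
  u * v = v * u -> u * w = w * u -> is_scalar_mx u.
Proof.
move=> e dv dw uv uw.
have [s [t eu]] := mx2_comm uv (anti_nonscalar e dv dw).
have t0 : t *: (v * w) = 0.
  apply: mx_addrr_eq0; move: uw; rewrite eu mulrDl mulrDr scalarMl scalarMr.
  move/addrI; rewrite -scalerAl -scalerAr (anti_sym e) scalerN => E.
  by rewrite {1}E addNr.
suff t0' : t = 0 by rewrite eu t0' scale0r addr0 scalar_mx_is_scalar.
move/eqP: t0; rewrite scaler_eq0 => /orP[/eqP//|].
by rewrite (negPf (det_neq0 _)) // detM mulf_neq0.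
Qed.

Lemma nilp_nonscalar K : K != 0 -> K * K = 0 -> ~~ is_scalar_mx K.
Proof.
move=> nK KK; apply/is_scalar_mxP=> -[a eK]; case/negP: nK.
move/eqP: KK; rewrite eK scalarMl scaler_eq0 => /orP[/eqP->|//].
by rewrite raddf0.
Qed.

(** The image of [K] is a line equal to its kernel, so [K * Y * K = 0] says that [Y] preserves
    it. *)
Lemma nilp_eigen K Y : K != 0 -> K * K = 0 -> K * Y * K = 0 ->
  exists t, Y * K = t *: K.
Proof.
move=> nK KK e.
have c : (Y * K) * K = K * (Y * K) by rewrite -mulrA KK mulr0 mulrA.
have [s [t eL]] := mx2_comm c (nilp_nonscalar nK KK); exists t.
have /eqP: s *: K = 0.
  have: (Y * K) * K = 0 by rewrite -mulrA KK mulr0.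
  by rewrite eL mulrDl scalarMl -scalerAl KK scaler0 addr0.
rewrite scaler_eq0 (negPf nK) orbF => /eqP s0.
by rewrite eL s0 raddf0 add0r.
Qed.

(** The prime field, as the set of roots of [a ^+ 3 - a]. *)
Definition inF3 a := a ^+ 3 == a.

Lemma inF3P a : inF3 a -> [\/ a = 0, a = 1 | a = -1].
Proof.
rewrite /inF3 -subr_eq0 (_ : _ - _ = a * ((a - 1) * (a + 1))); last by ring.
rewrite !mulf_eq0 subr_eq0 addr_eq0.
by case/or3P=> /eqP->; [constructor 1 | constructor 2 | constructor 3].
Qed.

(** An anticommutation makes the trace zero; otherwise [u] is a scalar of square 1. *)
Lemma commanti_trF3 v w u : v * w = - (w * v) -> \det v != 0 -> \det w != 0 ->
    \det u = 1 ->
    u * v = v * u \/ u * v = - (v * u) -> u * w = w * u \/ u * w = - (w * u) ->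
  inF3 (\tr u).
Proof.
have tr0 z : u * z = - (z * u) -> \det z != 0 -> inF3 (\tr u).
  by move=> e dz; rewrite (anti_tr0 e dz) /inF3 expr0n.
move=> e dv dw du [uv|uv]; last by move=> _; apply: tr0 uv _.
case=> uw; last by apply: tr0 uw _.
have /is_scalar_mxP[s es] := comm_anti_pair e dv dw uv uw.
move: du; rewrite es det_scalar mxtrace_scalar => s2; rewrite /inF3; apply/eqP.
apply: (@eq_mod3 _ _ (s *+ 2)).
have -> : (s *+ 2) ^+ 3 = s ^+ 2 * s *+ 8 by ring.
by rewrite s2; ring.
Qed.

(** If [y] has trace [b], its square has trace [b ^+ 2 - 2 = b ^+ 2 + 1]. The value 0 is excluded as
    -1 is a nonsquare; 1 and -1 give [b = 0] and [b ^+ 2 = 1]. *)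
Lemma inF3_tr_sqr y : \det y = 1 -> inF3 (\tr (y * y)) -> inF3 (\tr y).
Proof.
move=> dy; rewrite mx2_tr_sqr dy; move: (\tr y) => b.
have -> : b ^+ 2 - 1 *+ 2 = b ^+ 2 + 1.
  by apply: (@eq_mod3 _ _ (-1)); ring.
case/inF3P=> e.
- by case/negP: (nsqN1 b); rewrite -addr_eq0 e.
- by move: e; rewrite -{2}[1]add0r => /addIr/eqP; rewrite expf_eq0 => /eqP ->;
     rewrite /inF3 expr0n.
- have b2 : b ^+ 2 = 1.
    apply: (@eq_mod3 _ _ (-1)).
    have -> : b ^+ 2 = -1 - 1 by apply: (addIr 1); rewrite e; ring.
    by ring.
  by rewrite /inF3 exprS b2 mulr1.
Qed.

(** The cube has trace [b ^+ 3 - 3 b = b ^+ 3], and cubing is additive and injective. *)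
Lemma inF3_tr_cube y : \det y = 1 -> inF3 (\tr (y * y * y)) -> inF3 (\tr y).
Proof.
move=> dy; rewrite mx2_tr_cube dy; move: (\tr y) => b.
have -> : b ^+ 3 - (1 * b) *+ 3 = b ^+ 3.
  by apply: (@eq_mod3 _ _ (-b)); ring.
rewrite /inF3 => /eqP e; rewrite -subr_eq0 -[_ == 0](expf_eq0 _ 3); apply/eqP.
apply: (@eq_mod3 _ _ (b ^+ 5 - b ^+ 7)).
have -> : (b ^+ 3 - b) ^+ 3 = (b ^+ 3) ^+ 3 - 3%:R * b ^+ 7 + 3%:R * b ^+ 5 - b ^+ 3.
  by ring.
by rewrite e; ring.
Qed.

End CharThree.

(** * Solvabilizers and quotients *)

Section Solvabilizers.
Local Open Scope group_scope.
Variable gT : finGroupType.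
Implicit Types (G H K : {group gT}) (x y z : gT).

(** The group generated by [x] and [y] is an extension of its image by a subgroup of the solvable
    [K]. *)
Lemma Sol_coset G K x y : K <| G -> solvable K -> x \in G -> y \in G ->
  (coset K y \in Sol (G / K) (coset K x)) = (y \in Sol G x).
Proof.
case/andP=> sKG nKG solK Gx Gy; have [nx ny] := (subsetP nKG x Gx, subsetP nKG y Gy).
rewrite !inE mem_quotient // Gy /=.
have sH : [set x; y] \subset 'N(K) by rewrite subUset !sub1set nx ny.
have -> : <<[set coset K x; coset K y]>> = <<[set x; y]>> / K.
  by rewrite quotient_gen // /quotient morphimU !morphim_set1.
have nKH : <<[set x; y]>> \subset 'N(K) by rewrite gen_subG.
apply/idP/idP; last exact: quotient_sol.
rewrite -(isog_sol (second_isog nKH)) => sol.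
rewrite (series_sol (_ : K :&: <<[set x; y]>> <| _)) ?sol ?(solvableS (subsetIl _ _)) //.
by rewrite /normal subsetIr normsI ?normG.
Qed.

(** By [Sol_coset] a solvabilizer is determined by its image modulo [K], so taking images is a
    bijection. *)
Lemma card_Solv_quotient G K : K <| G -> solvable K -> #|Solv (G / K)| = #|Solv G|.
Proof.
move=> nKG solK; have SolE x : x \in G -> Sol (G / K) (coset K x) = Sol G x / K.
  move=> Gx; apply/setP=> Y; apply/idP/idP.
    move=> SY; have: Y \in G / K by move: SY; rewrite inE => /andP[].
    case/morphimP=> y ny Gy eY; rewrite eY in SY *.
    by apply: mem_morphim => //; rewrite -(Sol_coset nKG).
  case/morphimP=> y ny Sy ->; have Gy: y \in G by move: Sy; rewrite inE => /andP[].
  by rewrite (Sol_coset nKG).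
have -> : Solv (G / K) = [set A / K | A in Solv G].
  apply/setP=> S; apply/imsetP/imsetP => -[].
    move=> X /morphimP[x nx Gx ->] ->; rewrite SolE //.
    by exists (Sol G x) => //; apply: imset_f.
  move=> A /imsetP[x Gx ->] ->; exists (coset K x); first exact: mem_quotient.
  by rewrite SolE.
apply: card_in_imset => A B /imsetP[x Gx ->] /imsetP[x' Gx' ->].
rewrite -!SolE // => e; apply/setP=> y.
have [Gy|nGy] := boolP (y \in G); last by rewrite !inE (negPf nGy).
by rewrite -!(Sol_coset nKG) // e.
Qed.

Lemma Sol_mulr_norm G K x z : K <| G -> solvable K -> x \in G -> z \in K ->
  Sol G (x * z) = Sol G x.
Proof.
move=> nKG solK Gx Kz; have [/subsetP sKG _] := andP nKG.
apply/setP=> y; have [Gy|nGy] := boolP (y \in G); last by rewrite !inE (negPf nGy).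
have nx : x \in 'N(K) by apply: (subsetP (normal_norm nKG)).
have nz : z \in 'N(K) by apply: (subsetP (normG K)).
have e : coset K (x * z) = coset K x by rewrite morphM //= (coset_id Kz) mulg1.
rewrite -(Sol_coset nKG solK Gx Gy) -e (Sol_coset nKG) //.
by apply: groupM => //; apply: sKG.
Qed.

Lemma SolV G x : Sol G x^-1 = Sol G x.
Proof.
apply/setP=> y; rewrite !inE; congr (_ && solvable _).
have sub z : <<[set z^-1; y]>> \subset <<[set z; y]>>.
  by rewrite gen_subG subUset !sub1set groupV !mem_gen ?inE ?eqxx ?orbT.
by apply/eqP; rewrite eqEsubset sub -{1}[x]invgK sub.
Qed.

Lemma Sol_sym G x y : x \in G -> y \in G -> (y \in Sol G x) = (x \in Sol G y).
Proof. by move=> Gx Gy; rewrite !inE Gx Gy setUC. Qed.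

Lemma Sol_self G x : x \in G -> x \in Sol G x.
Proof. by move=> Gx; rewrite inE Gx setUid abelian_sol ?cycle_abelian. Qed.

Lemma Sol1 G : Sol G 1 = G.
Proof.
apply/setP=> y; rewrite inE; have [Gy|//] := boolP (y \in G).
apply: (solvableS (_ : _ \subset <[y]>)); last exact/abelian_sol/cycle_abelian.
by rewrite gen_subG subUset !sub1set group1 cycle_id.
Qed.

Lemma solvable_norm_joing (Q : {group gT}) x : solvable Q -> x \in 'N(Q) ->
  solvable (Q <*> <[x]>).
Proof.
move=> solQ nx; have nQx : <[x]> \subset 'N(Q) by rewrite cycle_subG.
have nQ : Q <| Q <*> <[x]> by rewrite /normal joing_subl join_subG normG.
rewrite (series_sol nQ) solQ quotientYidl // quotient_sol //.
exact/abelian_sol/cycle_abelian.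
Qed.

Lemma solvable_gen2_norm (Q : {group gT}) x y : solvable Q -> x \in 'N(Q) ->
  y \in Q -> solvable <<[set x; y]>>.
Proof.
move=> solQ nx Qy; apply: solvableS (solvable_norm_joing solQ nx).
rewrite gen_subG subUset !sub1set (subsetP (joing_subl _ _) y Qy) andbT.
exact: (subsetP (joing_subr _ _) x (cycle_id x)).
Qed.

(* The last derived subgroup of H that escapes Z. *)
Lemma solvable_layer H (Z : {group gT}) : solvable H -> ~~ (H \subset Z) ->
  exists V : {group gT},
    [/\ V <| H, ~~ (V \subset Z) & forall u v, u \in V -> v \in V -> [~ u, v] \in Z].
Proof.
move=> /derivedP[k Hk1] nHZ.
have exk : exists k, H^`(k) \subset Z by exists k; rewrite Hk1 sub1G.
case: (ex_minnP exk) => -[|j] Hj minj; first by rewrite Hj in nHZ.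
exists [group of H^`(j)]; split; first exact: der_normal.
  by apply/negP=> /minj; rewrite ltnn.
by move=> u v Vu Vv; apply: (subsetP Hj); apply: mem_commg.
Qed.
End Solvabilizers.

(** * Solvable subgroups of SL(2, q) *)

Section SL2Groups.
Local Open Scope group_scope.
Local Open Scope ring_scope.
Variable F : finFieldType.
(* Products of GL2 elements are thus found through finGroupType, as in the
   fingroup lemmas; the path through {unit _} is convertible but slow to unify. *)
Local Notation GL2 := (FinGroup.clone {'GL_2[F]} _).
Hypothesis char3 : 3%:R = 0 :> F.
Hypothesis nsqN1 : forall a : F, a ^+ 2 != -1.
Implicit Types (A B K M N X Y Z : 'M[F]_2) (a b c d s t : F).
Implicit Types (g h u v w x y z : GL2) (H V : {group GL2}).

(** Singular matrices go to the identity; determinant 1 rules this out wherever the matrix is read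
    back. *)
Definition gl A : GL2 := insubd (1%g : GL2) A.

Lemma val_gl A : \det A = 1 -> val (gl A) = A.
Proof. by move=> dA; rewrite insubdK // unitmxE dA unitr1. Qed.

Lemma valGM g h : val (g * h)%g = val g * val h :> 'M_2.
Proof. by []. Qed.

Lemma valG1 : val (1%g : GL2) = 1.
Proof. by []. Qed.

Lemma SL2_det g : g \in SL2 F -> \det (val g) = 1.
Proof. by rewrite inE => /eqP. Qed.

Lemma SL2_det_neq0 g : g \in SL2 F -> \det (val g) != 0.
Proof. by move/SL2_det->; rewrite oner_neq0. Qed.

Lemma gl_SL2 A : \det A = 1 -> gl A \in SL2 F.
Proof. by move=> dA; rewrite inE val_gl ?dA. Qed.

Lemma gl_val g : gl (val g) = g.
Proof. exact: valKd. Qed.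

Lemma valGJ g h : val g * val h = val h * val (g ^ h)%g :> 'M_2.
Proof. by rewrite -!valGM -conjgC. Qed.

Lemma valGJ_eq g h A : val g * val h = val h * A -> val (g ^ h)%g = A.
Proof.
rewrite valGJ; apply: mx2_mulI.
by have := valP h; rewrite -unitfE -unitmxE.
Qed.

Definition commanti A B := A * B = B * A \/ A * B = - (B * A).

Definition commantib A B := (A * B == B * A) || (A * B == - (B * A)).

Lemma commantiP A B : reflect (commanti A B) (commantib A B).
Proof. by apply: (iffP orP) => -[/eqP|/eqP]; [left | right | left | right]. Qed.

Lemma commanti_sym A B : commanti A B -> commanti B A.
Proof. by case=> e; [left | right]; rewrite e ?opprK. Qed.

Definition SL2_scalars : {set GL2} :=
  [set g in SL2 F | is_scalar_mx (val g)].

Lemma SL2_scalars_group_set : group_set SL2_scalars.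
Proof.
apply/group_setP; split; first by rewrite inE group1 scalar_mx_is_scalar.
move=> g h; rewrite !inE => /andP[/eqP dg /is_scalar_mxP[a ea]].
case/andP=> /eqP dh /is_scalar_mxP[b eb].
by rewrite valGM detM dg dh mulr1 eqxx ea eb scalarMl scale_scalar_mx scalar_mx_is_scalar.
Qed.
Canonical SL2_scalars_group := Group SL2_scalars_group_set.

Lemma SL2_scalars_central g h : g \in SL2_scalars -> commute g h.
Proof.
rewrite inE => /andP[_ /is_scalar_mxP[a ea]]; apply: val_inj.
by rewrite /= -[LHS]/(val g * val h) -[RHS]/(val h * val g) ea scalarMl scalarMr.
Qed.

Lemma SL2_scalars_normal : SL2_scalars <| SL2 F.
Proof.
rewrite /normal; apply/andP; split; first by apply/subsetP=> g; rewrite inE => /andP[].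
apply: cents_norm; apply/centsP=> h _ g Zg.
exact/commute_sym/SL2_scalars_central.
Qed.

Lemma SL2_scalars_sol : solvable SL2_scalars.
Proof.
by apply/abelian_sol/centsP=> g Zg h _; apply: SL2_scalars_central.
Qed.

Lemma Sol_gl_opp A : \det A = 1 -> Sol (SL2 F) (gl (- A)) = Sol (SL2 F) (gl A).
Proof.
move=> dA; have dN : \det (- A) = 1.
  by rewrite -scaleN1r detZ dA mulr1 expr2 mulrNN mulr1.
have d1 : \det (- (1 : 'M[F]_2)) = 1.
  by rewrite -scaleN1r detZ det1 mulr1 expr2 mulrNN mulr1.
have -> : gl (- A) = (gl A * gl (- (1 : 'M[F]_2)))%g.
  by apply: val_inj; rewrite valGM !val_gl // mulrN mulr1.
apply: (Sol_mulr_norm SL2_scalars_normal SL2_scalars_sol); first exact: gl_SL2.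
rewrite inE gl_SL2 // val_gl // -[1]/(1%:M : 'M[F]_2) -raddfN.
exact: scalar_mx_is_scalar.
Qed.

Lemma commutator_scalar_commanti g h : [~ g, h]%g \in SL2_scalars ->
  commanti (val g) (val h).
Proof.
rewrite inE => /andP[/SL2_det dgh /is_scalar_mxP[a ea]].
have: val g * val h = val h * val g * val [~ g, h]%g.
  by rewrite -!valGM -commgC.
move: dgh; rewrite ea det_scalar scalarMr => /eqP; rewrite sqrf_eq1.
by case/orP=> /eqP->; rewrite ?scale1r ?scaleN1r; [left | right].
Qed.

(** Take the layer given by [solvable_layer] modulo scalars. Without an anticommuting pair it is
    commutative, so conjugation by [h] sends a nonscalar [v] of it into [F[v]] and rescales the
    traceless part of [v]. *)
Lemma solvable_SL2_cases H : H \subset SL2 F -> solvable H ->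
    (exists2 h, h \in H & ~~ is_scalar_mx (val h)) ->
  (exists X, [/\ \tr X = 0, X != 0 &
     forall h, h \in H -> exists t, X * val h = t *: (val h * X)])
  \/ (exists V v w, [/\ V <| H, v \in V, w \in V,
        val v * val w = - (val w * val v) &
        forall u u', u \in V -> u' \in V -> commanti (val u) (val u')]).
Proof.
move=> sH solH [h0 Hh0 ns0].
have nHZ : ~~ (H \subset SL2_scalars).
  by apply/negP=> /subsetP/(_ _ Hh0); rewrite inE (negPf ns0) andbF.
have [V [nV nVZ cV]] := solvable_layer solH nHZ.
have caV u u' : u \in V -> u' \in V -> commanti (val u) (val u').
  by move=> Vu Vu'; apply: commutator_scalar_commanti; apply: cV.
have [/existsP[v /andP[Vv /existsP[w /andP[Vw /eqP e]]]]|nAnti] :=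
    boolP [exists v in V, [exists w in V, val v * val w == - (val w * val v)]].
  by right; exists V, v, w.
left; have [sVH nVH] := andP nV.
case/subsetPn: nVZ => v Vv; rewrite inE (subsetP sH v (subsetP sVH v Vv)) /= => nsv.
have commV u u' : u \in V -> u' \in V -> val u * val u' = val u' * val u.
  move=> Vu Vu'; case: (caV u u' Vu Vu') => // e; case/negP: nAnti.
  by apply/existsP; exists u; rewrite Vu; apply/existsP; exists u'; rewrite Vu' e eqxx.
have h2 := two_neq0 char3.
pose X : 'M[F]_2 := val v - (\tr (val v) / 2%:R)%:M.
have trX : \tr X = 0.
  by rewrite raddfB /= mxtrace_scalar -(mulr_natr (_ / _)) mulfVK // subrr.
exists X; split=> //.
  apply: contraNneq nsv => /eqP; rewrite subr_eq0 => /eqP ->.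
  exact: scalar_mx_is_scalar.
move=> h Hh; have Vvh : (v ^ h)%g \in V by rewrite memJ_norm // (subsetP nVH).
have [s [t e]] := mx2_comm (commV _ _ Vvh Vv) nsv; exists t.
have dh : \det (val h) != 0 by rewrite SL2_det_neq0 ?(subsetP sH).
have trvh : \tr (val (v ^ h)%g : 'M_2) = \tr (val v : 'M_2).
  have uh : (val h : 'M[F]_2) \in unitmx by rewrite unitmxE unitfE.
  have -> : val (v ^ h)%g = invmx (val h) * (val v * val h) :> 'M_2.
    by rewrite valGJ -!mulmxE mulKmx.
  by rewrite -!mulmxE mxtrace_mulC mulmxK.
have eX : val (v ^ h)%g - (\tr (val v) / 2%:R)%:M = t *: X.
  have es : s = \tr (val v) / 2%:R - t * (\tr (val v) / 2%:R).
    move: trvh; rewrite e raddfD /= linearZ /= mxtrace_scalar => e'.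
    by apply: (mulIf h2); rewrite mulr_natr -(addrK (t * \tr (val v)) (s *+ 2)) e'; field.
  rewrite e es /X raddfB /= scalerBr scale_scalar_mx.
  by rewrite addrAC [X in X + _]addrAC subrr add0r addrC.
by rewrite scalerAr -eX mulrBl mulrBr valGJ scalarMl scalarMr.
Qed.

End SL2Groups.

(** * Groups acting on a layer with an anticommuting pair *)

Section Quaternion.
Local Open Scope group_scope.
Local Open Scope ring_scope.
Variable F : finFieldType.
Local Notation GL2 := (FinGroup.clone {'GL_2[F]} _).
Hypothesis char3 : 3%:R = 0 :> F.
Hypothesis nsqN1 : forall a : F, a ^+ 2 != -1.
Implicit Types (A B K M N X Y Z : 'M[F]_2) (a b c d s t : F).
Implicit Types (g h u v w x y z : GL2) (H V : {group GL2}).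

Lemma tr0_det1_sqr X : \tr X = 0 -> \det X = 1 -> X * X = -1.
Proof. by move=> tX dX; rewrite tr0_sqr // dX raddfN. Qed.

Lemma tr0_comm_pm X Y : X * Y = Y * X -> \tr X = 0 -> \tr Y = 0 ->
  \det X = 1 -> \det Y = 1 -> X = Y \/ X = - Y.
Proof.
move=> e tX tY dX dY; have nY : Y != 0 by rewrite det_neq0 // dY oner_neq0.
have [t eX] := comm_tr0 char3 e tX tY nY.
move: dX; rewrite eX detZ dY mulr1 => /eqP; rewrite sqrf_eq1.
by case/orP=> /eqP->; rewrite ?scale1r ?scaleN1r; [left | right].
Qed.

(** [X * Y] commutes with [A] and [B], hence is scalar, and [Y * Y = -1] turns this into
    proportionality: a single line is orthogonal to both [A] and [B]. *)
Lemma anti_pair_pm A B X Y : A * B = - (B * A) -> \det A = 1 -> \det B = 1 ->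
    \det X = 1 -> \det Y = 1 ->
    X * A = - (A * X) -> X * B = - (B * X) ->
    Y * A = - (A * Y) -> Y * B = - (B * Y) ->
  X = Y \/ X = - Y.
Proof.
move=> e dA dB dX dY xA xB yA yB.
have n1 (Z : 'M[F]_2) : \det Z = 1 -> \det Z != 0 by move->; rewrite oner_neq0.
have tX := anti_tr0 char3 xA (n1 _ dA); have tY := anti_tr0 char3 yA (n1 _ dA).
apply: tr0_comm_pm => //.
have cA : (X * Y) * A = A * (X * Y).
  by rewrite -mulrA yA mulrN (mulrA X) xA mulNr opprK !mulrA.
have cB : (X * Y) * B = B * (X * Y).
  by rewrite -mulrA yB mulrN (mulrA X) xB mulNr opprK !mulrA.
have /is_scalar_mxP[s es] := comm_anti_pair char3 e (n1 _ dA) (n1 _ dB) cA cB.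
have eX : X = - s *: Y.
  have : X * Y * Y = s *: Y by rewrite es scalarMl.
  by rewrite -mulrA tr0_det1_sqr // mulrN mulr1 scaleNr => <-; rewrite opprK.
by rewrite eX -scalerAl -scalerAr.
Qed.

Lemma antiJ u v h : val u * val v = - (val v * val u) ->
  val (u ^ h)%g * val (v ^ h)%g = - (val (v ^ h)%g * val (u ^ h)%g) :> 'M_2.
Proof.
move=> e; rewrite -!valGM -!conjMg; apply: valGJ_eq.
by rewrite mulrN -valGJ valGM e mulNr valGM.
Qed.

Lemma tr_valGJ u h : \tr (val (u ^ h)%g : 'M_2) = \tr (val u : 'M_2).
Proof.
have uh : (val h : 'M[F]_2) \in unitmx := valP h.
have -> : val (u ^ h)%g = invmx (val h) * (val u * val h) :> 'M_2.
  by rewrite valGJ -!mulmxE mulKmx.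
by rewrite -!mulmxE mxtrace_mulC mulmxK.
Qed.

Lemma val_pmJ u v h : val u = val v \/ val u = - val v :> 'M_2 ->
  val (u ^ h)%g = val (v ^ h)%g \/ val (u ^ h)%g = - val (v ^ h)%g :> 'M_2.
Proof.
case=> e; [left | right]; apply: valGJ_eq; rewrite e ?mulrN -valGJ //.
by rewrite mulNr.
Qed.

Section Layer.
Variables (H V : {group GL2}) (a b : GL2).
Hypotheses (sH : H \subset SL2 F) (nV : V <| H) (Va : a \in V) (Vb : b \in V).
Hypothesis anti_ab : val a * val b = - (val b * val a).
Hypothesis commantiV :
  forall u u', u \in V -> u' \in V -> commanti (val u) (val u').

Let detH h : h \in H -> \det (val h) = 1.
Proof. by move=> Hh; apply/SL2_det/(subsetP sH). Qed.
Let VH v : v \in V -> v \in H.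
Proof. exact: (subsetP (normal_sub nV)). Qed.
Let detV v : v \in V -> \det (val v) = 1.
Proof. by move/VH/detH. Qed.
Let VJ v h : v \in V -> h \in H -> (v ^ h)%g \in V.
Proof. by move=> Vv Hh; rewrite memJ_norm ?(subsetP (normal_norm nV)). Qed.
Let neq0V v : v \in V -> \det (val v) != 0.
Proof. by move/detV->; rewrite oner_neq0. Qed.
Let det1_neq0 A : \det A = 1 -> \det A != 0.
Proof. by move->; rewrite oner_neq0. Qed.

(** Only scalars commute with both [a] and [b], so [v] anticommutes with one of them. *)
Lemma layer_tr0 v y : v \in V -> ~ commanti (val v) (val y) -> \tr (val v) = 0.
Proof.
move=> Vv nvy.
have [ca|ca] := commantiV Vv Va; last exact: (anti_tr0 char3 ca (neq0V Va)).
have [cb|cb] := commantiV Vv Vb; last exact: (anti_tr0 char3 cb (neq0V Vb)).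
have := comm_anti_pair char3 anti_ab (neq0V Va) (neq0V Vb) ca cb.
by case/is_scalar_mxP=> s es; case: nvy; left; rewrite es scalarMl scalarMr.
Qed.

(** Were [v] and [v ^ y] to commute, they would agree up to sign, being traceless of determinant
    1. *)
Lemma layer_conj_anti v y : v \in V -> y \in H -> ~ commanti (val v) (val y) ->
  val v * val (v ^ y)%g = - (val (v ^ y)%g * val v).
Proof.
move=> Vv Hy nvy; have tv := layer_tr0 Vv nvy; have Vw := VJ Vv Hy.
have [e|//] := commantiV Vv Vw; case: nvy.
have tw : \tr (val (v ^ y)%g : 'M_2) = 0 by rewrite tr_valGJ.
have [e1|e1] := tr0_comm_pm e tv tw (detV Vv) (detV Vw).
  by left; rewrite {2}e1 -valGJ.
by right; rewrite {2}e1 mulrN -valGJ opprK.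
Qed.

(** If [y] does not fix [v] up to sign, the orbit [v], [w = v ^ y], [u = w ^ y] closes up to sign
    after two or three steps. The square or the cube of [y] then fixes the pair [v], [w] up to sign,
    so its trace is in F_3. *)
Lemma layer_trF3 y : y \in H -> inF3 (\tr (val y)).
Proof.
move=> Hy.
have [/forall_inP cV|] := boolP [forall v in V, commantib (val v) (val y)].
  have cy v (Vv : v \in V) := commanti_sym (elimT (commantiP _ _) (cV v Vv)).
  exact: (commanti_trF3 char3 anti_ab (neq0V Va) (neq0V Vb) (detH Hy)
            (cy a Va) (cy b Vb)).
case/forall_inPn=> v Vv /commantiP nvy.
set w := (v ^ y)%g; have Vw : w \in V by apply: VJ.
set u := (w ^ y)%g; have Vu : u \in V by apply: VJ.
have vw : val v * val w = - (val w * val v) by apply: layer_conj_anti.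
have wu : val w * val u = - (val u * val w) := antiJ y vw.
have tv := layer_tr0 Vv nvy.
have tw : \tr (val w : 'M_2) = 0 by rewrite tr_valGJ.
have tu : \tr (val u : 'M_2) = 0 by rewrite tr_valGJ.
have trF3 k : k \in H ->
    val (v ^ k)%g = val v \/ val (v ^ k)%g = - val v :> 'M_2 ->
    val (w ^ k)%g = val w \/ val (w ^ k)%g = - val w :> 'M_2 ->
    inF3 (\tr (val k)).
  move=> Hk ev ew.
  have kc z : val (z ^ k)%g = val z \/ val (z ^ k)%g = - val z :> 'M_2 ->
      val k * val z = val z * val k \/ val k * val z = - (val z * val k).
    by case=> e; [left | right]; rewrite (valGJ z k) e ?mulrN ?opprK.
  exact: (commanti_trF3 char3 vw (neq0V Vv) (neq0V Vw) (detH Hk)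
            (kc v ev) (kc w ew)).
(* If [u] commutes with [v], it is [v] up to sign; otherwise [v] and [u ^ y] both anticommute with
   [w] and [u], hence agree up to sign. *)
have [uv|uv] := commantiV Vu Vv.
  have e := tr0_comm_pm uv tu tv (detV Vu) (detV Vv).
  apply: (inF3_tr_sqr char3 nsqN1 (detH Hy)); rewrite -valGM.
  by apply: (trF3 _ (groupM Hy Hy)); rewrite conjgM; [|apply: (val_pmJ y e)].
set u' := (u ^ y)%g; have Vu' : u' \in V by apply: VJ.
have u'u : val u' * val u = - (val u * val u') := anti_sym (antiJ y wu).
have u'w : val u' * val w = - (val w * val u') := antiJ y uv.
have e : val u' = val v \/ val u' = - val v :> 'M_2.
  exact: (anti_pair_pm wu (detV Vw) (detV Vu) (detV Vu') (detV Vv) u'w u'u vw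
            (anti_sym uv)).
apply: (inF3_tr_cube char3 (detH Hy)); rewrite -!valGM.
have Hyyy := groupM (groupM Hy Hy) Hy.
by apply: (trF3 _ Hyyy); rewrite !conjgM; [|apply: (val_pmJ y e)].
Qed.

(** Up to sign [y] lies in the layer, so [y] and [y ^ x] commute or anticommute. Commuting is
    impossible, and anticommuting is the trace equation. *)
Lemma layer_unipotent x y N : x \in H -> y \in H -> val x = 1 + N -> \tr N = 0 ->
  \det N = 0 -> N != 0 -> \tr (val y) = 0 -> (\tr (val y * N)) ^+ 2 = 1.
Proof.
move=> Hx Hy ex tN dN nN ty; have h2 := two_neq0 char3.
have yy := tr0_det1_sqr ty (detH Hy).
(* Otherwise [y] swaps the anticommuting [v] and [w], so it commutes with [v + w], whose square is
   -2. Then [y = t (v + w)] gives [2 t ^+ 2 = 1], that is [t ^+ 2 = -1]. *)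
have cV v : v \in V -> commanti (val v) (val y).
  move=> Vv; have [//|nvy] := commantiP (val v) (val y).
  set w := (v ^ y)%g; have Vw : w \in V by apply: VJ.
  have vw : val v * val w = - (val w * val v) by apply: layer_conj_anti.
  have ew : val w * val y = val y * val v.
    rewrite valGJ; congr (_ * _); rewrite /w -conjgM; apply: valGJ_eq.
    by rewrite valGM yy mulrN mulNr mulr1 mul1r.
  have tv := layer_tr0 Vv nvy.
  have tw : \tr (val w : 'M_2) = 0 by rewrite tr_valGJ.
  have tS : \tr (val v + val w) = 0 by rewrite raddfD /= tv tw addr0.
  have SS : (val v + val w) * (val v + val w) = - (1 *+ 2).
    rewrite mulrDl !mulrDr !tr0_det1_sqr ?detV // vw addrA subrK.
    by rewrite -opprD mulr2n.
  have nS : val v + val w != 0.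
    apply: contraNneq h2 => S0; move: SS; rewrite S0 mul0r => /esym/eqP.
    by rewrite oppr_eq0 -scaler_nat scaler_eq0 oner_eq0 orbF.
  have yS : val y * (val v + val w) = (val v + val w) * val y.
    by rewrite mulrDr mulrDl ew -valGJ addrC.
  have [t et] := comm_tr0 char3 yS ty tS nS.
  have: (t ^+ 2 *+ 2) *: (1 : 'M[F]_2) = 1.
    apply: oppr_inj; rewrite -yy {1}et {1}et -scalerAl -scalerAr SS scalerA.
    by rewrite -expr2 scalerN -scalerMnr scalerMnl.
  move/(congr1 (fun A : 'M[F]_2 => A 0 0)); rewrite !mxE /= mulr1 mulr1n => t2.
  case/negP: (nsqN1 t); apply/eqP.
  by apply: (eq_mod3 char3 (e := t ^+ 2)); rewrite opprK -[X in _ + X]t2; ring.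
(* If [y] commutes with [a] or [b], it equals it up to sign; otherwise it anticommutes with both, as
   [a * b] does. *)
have yV : exists2 z, z \in V & val y = val z \/ val y = - val z :> 'M_2.
  have ta : \tr (val a) = 0 := anti_tr0 char3 anti_ab (neq0V Vb).
  have tb : \tr (val b) = 0 := anti_tr0 char3 (anti_sym anti_ab) (neq0V Va).
  have [ca|ca] := cV a Va.
    exists a => //; exact: (tr0_comm_pm (esym ca) ty ta (detH Hy) (detV Va)).
  have [cb|cb] := cV b Vb.
    exists b => //; exact: (tr0_comm_pm (esym cb) ty tb (detH Hy) (detV Vb)).
  have [c Vc ec] : exists2 c, c \in V & val c = val a * val b.
    by eexists; [exact: (groupM Va Vb) | exact: valGM].
  exists c => //.
  apply: (anti_pair_pm anti_ab (detV Va) (detV Vb) (detH Hy) (detV Vc)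
    (anti_sym ca) (anti_sym cb)).
    by rewrite ec -mulrA (anti_sym anti_ab) mulrN.
  by rewrite ec mulrA (anti_sym anti_ab) mulNr opprK.
have [z Vz ez] := yV; have Hyx : (y ^ x)%g \in H.
  by rewrite memJ_norm ?(subsetP (normG H)).
have tyx : \tr (val (y ^ x)%g : 'M_2) = 0 by rewrite tr_valGJ.
have tx : \tr (val x) = 2%:R by rewrite ex raddfD /= tN addr0 mxtrace1.
have dx : \det (val x) != 0 by rewrite det1_neq0 ?detH.
have NN : N * N = 0 by rewrite tr0_sqr // dN oppr0 raddf0.
have [c|an] : commanti (val y) (val (y ^ x)%g).
  have := commantiV Vz (VJ Vz Hx).
  case: (val_pmJ x ez) (ez) => -> [] ->; rewrite /commanti ?mulrN ?mulNr ?opprK //.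
    by case=> ->; rewrite ?opprK; auto.
  by case=> ->; rewrite ?opprK; auto.
  (* [y ^ x = y] would make [y] a multiple of the singular [N]; [y ^ x = - y] would make [x]
     traceless, while its trace is 2. *)
  case: (tr0_comm_pm c ty tyx (detH Hy) (detH Hyx)) => e.
    have yN : val y * N = N * val y.
      have := valGJ y x; rewrite -e ex mulrDr mulrDl mulr1 mul1r.
      by move/addrI.
    have [t et] := comm_tr0 char3 yN ty tN nN.
    by have := detH Hy; rewrite et detZ dN mulr0 => /esym/eqP; rewrite oner_eq0.
  have xy : val x * val y = - (val y * val x).
    by rewrite e mulrN; congr (- _); rewrite -valGJ -e.
  have := anti_tr0 char3 xy (det1_neq0 (detH Hy)).
  by rewrite tx => /eqP; rewrite (negPf h2).
have eyx : val (y ^ x)%g = (1 - N) * (val y * (1 + N)).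
  by apply: valGJ_eq; rewrite ex mulrA unip_mulV // mul1r.
have: \tr (val y * val (y ^ x)%g) = 0.
  apply/eqP; rewrite -(addrr_eq0 char3) {2}an raddfN /= -!mulmxE.
  by rewrite mxtrace_mulC subrr.
rewrite eyx tr_mul_conj_unip // (detH Hy) dN mulr0 mul0rn subr0 => /eqP; rewrite oppr_eq0 addr_eq0 => /eqP e.
apply: (eq_mod3 char3 (e := -1)); rewrite -[_ ^+ 2]opprK -e; ring.
Qed.

End Layer.
End Quaternion.

(** * Solvable pairs containing a regular semisimple element *)

Section SolvablePairs.
Local Open Scope group_scope.
Local Open Scope ring_scope.
Variable F : finFieldType.
Local Notation GL2 := (FinGroup.clone {'GL_2[F]} _).
Hypothesis char3 : 3%:R = 0 :> F.
Hypothesis nsqN1 : forall a : F, a ^+ 2 != -1.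
Implicit Types (A B K M N X Y Z : 'M[F]_2) (a b c d s t al be : F).
Implicit Types (g h u v w x y z : GL2) (H V : {group GL2}).

Section Borel.
Variable K : 'M[F]_2.
Hypotheses (trK : \tr K = 0) (detK : \det K = 0) (nK : K != 0).

(** The stabiliser of the line that is the image of the nilpotent [K]; [unirad] fixes this line
    pointwise. *)
Definition borel : {set GL2} :=
  [set g in SL2 F | [exists t, val g * K == t *: K]].
Definition unirad : {set GL2} := [set g in SL2 F | val g * K == K].

Lemma borel_group_set : group_set borel.
Proof.
apply/group_setP; split.
  by rewrite inE group1; apply/existsP; exists 1; rewrite valG1 mul1r scale1r.
move=> g h; rewrite inE => /andP[Gg /existsP[s /eqP es]].
rewrite inE => /andP[Gh /existsP[t /eqP et]]; rewrite inE groupM //=.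
by apply/existsP; exists (t * s); rewrite -mulrA et -scalerAr es scalerA.
Qed.
Canonical borel_group := Group borel_group_set.

Lemma mem_borel g t : g \in SL2 F -> val g * K = t *: K -> g \in borel.
Proof. by move=> Gg e; rewrite inE Gg; apply/existsP; exists t; rewrite e. Qed.

Lemma unirad_group_set : group_set unirad.
Proof.
apply/group_setP; split; first by rewrite inE group1 valG1 mul1r eqxx.
move=> g h; rewrite inE => /andP[Gg /eqP es]; rewrite inE => /andP[Gh /eqP et].
by rewrite inE groupM //= -mulrA et es.
Qed.
Canonical unirad_group := Group unirad_group_set.

Lemma unirad_shape g : g \in unirad -> exists t, val g = 1 + t *: K.
Proof.
rewrite inE => /andP[/SL2_det dg /eqP eg]; pose N : 'M[F]_2 := val g - 1.
have NK : N * K = 0 by rewrite mulrBl eg mul1r subrr.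
have dN : \det N = 0.
  apply/eqP; apply: contraNT nK => dN; apply/eqP/(mx2_mulI dN).
  by rewrite NK mulr0.
have eN : val g = 1 + N by rewrite addrC subrK.
have tN : \tr N = 0.
  have : \det (1 + N) = 1 + \tr N + \det N.
    by rewrite [N]mx2_eta !mx2E; ring.
  by rewrite -eN dg dN addr0 -{1}[1]addr0 => /addrI.
have KN : K * N = 0.
  by have := tr0_anticomm trK tN; rewrite NK mxtrace_mulC mulmxE NK raddf0 addr0 raddf0.
have [|t et] := comm_tr0 char3 (_ : N * K = K * N) tN trK nK; first by rewrite NK KN.
by exists t; rewrite eN et.
Qed.

(** Elements act on the line of [K] by scalars, so commutators act trivially on it and lie in
    [unirad], which is abelian. *)
Lemma borel_sol : solvable borel.
Proof.
have abU : abelian unirad.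
  apply/centsP=> g /unirad_shape[s es] h /unirad_shape[t et]; apply: val_inj.
  rewrite -[LHS]/(val g * val h) -[RHS]/(val h * val g) es et.
  have KK : K * K = 0 by rewrite tr0_sqr // detK oppr0 raddf0.
  rewrite !mulrDl !mulrDr !mulr1 !mul1r -!scalerAl -!scalerAr KK !scaler0 !addr0.
  exact: addrAC.
have sBU : [~: borel, borel]%g \subset unirad.
  rewrite gen_subG; apply/subsetP=> _ /imset2P[g h Bg Bh ->].
  rewrite inE; apply/andP; split.
    have /subsetP sB : borel \subset SL2 F by apply/subsetP=> k; rewrite inE => /andP[].
    by rewrite groupR ?sB.
  move: Bg Bh; rewrite inE => /andP[Gg /existsP[s /eqP es]].
  rewrite inE => /andP[Gh /existsP[t /eqP et]].
  have dhg : \det (val (h * g)%g) != 0 by rewrite SL2_det_neq0 ?groupM.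
  apply/eqP/(mx2_mulI dhg); rewrite mulrA -valGM -commgC !valGM -!mulrA es et.
  by rewrite -!scalerAr es et !scalerA mulrC.
apply/derivedP; exists 2; apply/trivgP; apply: subset_trans (commgSS sBU sBU) _.
by rewrite (commG1P abU).
Qed.

End Borel.

(** The left-hand side is the commutator of [A * A] with [B], and Cayley-Hamilton makes [A * A]
    equal to [\tr A *: A] up to a scalar. *)
Lemma commutator_anticomm A B :
  (A * B - B * A) * A + A * (A * B - B * A) = \tr A *: (A * B - B * A).
Proof.
by rewrite [A]mx2_eta [B]mx2_eta !mx2E; congr mx2; ring.
Qed.

(** A singular commutator is nilpotent, and [commutator_anticomm] yields [K * A * K = 0]. *)
Lemma commutator_eigen A B : let K := A * B - B * A in
  K != 0 -> \det K = 0 -> exists t, A * K = t *: K.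
Proof.
move=> K nK dK; have tK : \tr K = 0.
  by rewrite raddfB /= -!mulmxE mxtrace_mulC subrr.
have KK : K * K = 0 by rewrite tr0_sqr // dK oppr0 raddf0.
apply: nilp_eigen => //.
have e := commutator_anticomm A B; rewrite -/K in e.
have -> : K * A = \tr A *: K - A * K by rewrite -e addrK.
by rewrite mulrBl -scalerAl -mulrA KK mulr0 scaler0 subr0.
Qed.

Lemma scaled_comm_pm X B t : X * B = t *: (B * X) -> \det X != 0 ->
  \det B != 0 -> commanti X B.
Proof.
move=> e dX dB; have /eqP := congr1 determinant e.
rewrite detM detZ detM [\det B * _]mulrC -{1}[_ * _]mul1r.
move/eqP/(mulIf (mulf_neq0 dX dB))/esym/eqP; rewrite sqrf_eq1.
by case/orP=> /eqP et; move: e; rewrite et ?scale1r ?scaleN1r; [left | right].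
Qed.

Lemma comm_affine al be M X : be != 0 ->
  (X * (al%:M + be *: M) == (al%:M + be *: M) * X) = (X * M == M * X).
Proof.
move=> nb; rewrite mulrDr mulrDl scalarMl scalarMr -scalerAl -scalerAr.
by rewrite (inj_eq (addrI _)) (inj_eq (scalerI nb)).
Qed.

Lemma regular_trace al be M y : y \in SL2 F -> val y = al%:M + be *: M ->
  \tr M = 0 -> \tr (val y) = al *+ 2.
Proof.
by move=> Gy -> tM; rewrite raddfD /= linearZ /= tM mulr0 addr0 mxtrace_scalar.
Qed.

Lemma det_affine al be M : \tr M = 0 ->
  \det (al%:M + be *: M) = al ^+ 2 + be ^+ 2 * \det M.
Proof. by move=> /tr0_mx2[p [q [r ->]]]; rewrite !mx2E; ring. Qed.

Lemma affine_adj al be M : \tr M = 0 ->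
  (al%:M + be *: M) * (al%:M - be *: M) = (\det (al%:M + be *: M))%:M.
Proof.
by move=> /tr0_mx2[p [q [r ->]]]; rewrite !mx2E; congr mx2; ring.
Qed.

(** The trace is [2 al]. If it lay in F_3, then [al ^+ 2 = 1], and [\det y = 1] would leave
    [be ^+ 2 * \det M = 0]. *)
Lemma regular_not_trF3 al be M y : y \in SL2 F -> val y = al%:M + be *: M ->
  \tr M = 0 -> \det M != 0 -> al != 0 -> be != 0 -> ~~ inF3 (\tr (val y)).
Proof.
move=> Gy ey tM dM na nb; rewrite (regular_trace Gy ey tM).
have dy : al ^+ 2 + be ^+ 2 * \det M = 1 by rewrite -(SL2_det Gy) ey det_affine.
apply/negP; rewrite /inF3 => /eqP e.
have : al * (al ^+ 2 - 1) = 0.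
  apply: (eq_mod3 char3 (e := 3%:R * al ^+ 3 - al)).
  by apply: (eq_of_sub (esym e)); ring.
move/eqP; rewrite mulf_eq0 (negPf na) subr_eq0 /= => /eqP a1.
move/eqP: dy; rewrite a1 -{2}[1]addr0 (inj_eq (addrI _)) mulf_eq0 (negPf dM).
by rewrite expf_eq0 (negPf nb).
Qed.

(** The solvable shapes are a common eigenline, the normaliser of the torus of [M], and a quaternion
    layer; the trace of [y] excludes the last. *)
Lemma regular_solvable al be M x y : x \in SL2 F -> y \in SL2 F ->
    val y = al%:M + be *: M -> \tr M = 0 -> \det M != 0 -> al != 0 -> be != 0 ->
  solvable <<[set x; y]>> <->
  \det (val x * M - M * val x) = 0 \/ val x * M = - (M * val x).
Proof.
move=> Gx Gy ey tM dM na nb; have h2 := two_neq0 char3.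
have nM := det_neq0 dM; have dx := SL2_det_neq0 Gx; have dy := SL2_det_neq0 Gy.
split=> [sol | [dK | anti]].
- have sH : <<[set x; y]>> \subset SL2 F.
    by rewrite gen_subG; apply/subsetP=> z /set2P[]->.
  have Hx : x \in <<[set x; y]>> by rewrite mem_gen ?set21.
  have Hy : y \in <<[set x; y]>> by rewrite mem_gen ?set22.
  case: (solvable_SL2_cases char3 sH sol).
  + exists y => //; apply/negP=> /is_scalar_mxP[s es].
    case/negP: (tr0_nonscalar char3 tM nM); apply/is_scalar_mxP.
    exists (be^-1 * (s - al)); rewrite -scale_scalar_mx raddfB /= -es ey.
    by rewrite addrC addKr scalerA mulVf // scale1r.
  + case=> X [tX nX cX]; have [t et] := cX y Hy; have [s es] := cX x Hx.
    (* If [X] is nilpotent, [x] and [M] act by scalars on its image, which their commutator kills.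
       If not, [M] commutes with [X] because [y] has nonzero trace, and so is a multiple of [X]. *)
    have [dX|dX] := eqVneq (\det X) 0; [left | ].
      have XX : X * X = 0 by rewrite tr0_sqr // dX oppr0 raddf0.
      have eig h r : X * val h = r *: (val h * X) -> exists r', val h * X = r' *: X.
        by move=> e; apply: nilp_eigen => //; rewrite e -scalerAl -mulrA XX mulr0 scaler0.
      have [s' es'] := eig x s es; have [t' et'] := eig y t et.
      have eM : M * X = ((t' - al) / be) *: X.
        move: et'; rewrite ey mulrDl scalarMl -scalerAl => e.
        apply: (scalerI nb); rewrite scalerA mulrC divfK // scalerBl -e.
        by rewrite addrC addKr.
      apply/eqP; apply: contraNT nX => dK; apply/eqP/(mx2_mulI dK).
      by rewrite mulr0 mulrBl -!mulrA eM es' -!scalerAr es' eM !scalerA mulrC subrr.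
    have cXM : X * M = M * X.
      apply/eqP; rewrite -(comm_affine al _ _ nb) -ey; apply/eqP.
      case: (scaled_comm_pm et dX dy) => // /anti_sym /(anti_tr0 char3)/(_ dX).
      rewrite (regular_trace Gy ey tM) -mulr_natr => /eqP.
      by rewrite mulf_eq0 (negPf na) (negPf h2).
    have [r er] := comm_tr0 char3 (esym cXM) tM tX nX.
    case: (scaled_comm_pm es dX dx) => e; [left | right].
      by rewrite er -scalerAl -scalerAr e subrr det0.
    by rewrite er -scalerAl -scalerAr e scalerN opprK.
  + case=> V [a [b [nV Va Vb ab cV]]].
    by have := layer_trF3 char3 nsqN1 sH nV Va Vb ab cV Hy;
       rewrite (negPf (regular_not_trF3 Gy ey tM dM na nb)).
(* A zero commutator makes [x] centralise [y]; a nonzero singular one is nilpotent, and its Borel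
   subgroup contains [x] and [y]. *)
- have [K0|nK] := eqVneq (val x * M - M * val x) 0.
    apply: (solvable_gen2_norm (Q := <[y]>)); rewrite ?cycle_id //.
      exact/abelian_sol/cycle_abelian.
    apply/normP; rewrite -cycleJ; congr <[_]>; apply: val_inj; apply: valGJ_eq.
    by apply/esym/eqP; rewrite ey comm_affine // -subr_eq0 K0.
  set K := val x * M - M * val x in dK nK.
  have tK : \tr K = 0 by rewrite raddfB /= -!mulmxE mxtrace_mulC subrr.
  apply: (solvableS _ (borel_sol tK dK nK)).
  rewrite gen_subG subUset !sub1set; apply/andP; split.
    by have [t et] := commutator_eigen nK dK; apply: mem_borel et.
  have nK' : M * val x - val x * M != 0 by rewrite -opprB oppr_eq0.
  have dK' : \det (M * val x - val x * M) = 0.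
    by rewrite -opprB -scaleN1r detZ -/K dK mulr0.
  have [t et] := commutator_eigen nK' dK'.
  apply: (@mem_borel _ _ (al + be * t)) => //.
  have eMK : M * K = t *: K by apply: oppr_inj; rewrite -mulrN -scalerN opprB.
  by rewrite ey mulrDl scalarMl -scalerAl eMK scalerA scalerDl.
(* Here [x] conjugates [al + be M] to [al - be M], the inverse of [y]. *)
- apply: (solvable_gen2_norm (Q := <[y]>)); rewrite ?cycle_id //.
    exact/abelian_sol/cycle_abelian.
  apply/normP; rewrite -cycleJ -[RHS]cycleV; congr <[_]>; apply: val_inj.
  apply: valGJ_eq; have eV : val (y^-1)%g = al%:M - be *: M.
    apply: (mx2_mulI dy); rewrite -valGM mulgV ey affine_adj // -ey.
    by rewrite (SL2_det Gy).
  rewrite eV ey mulrDl mulrBr scalarMl scalarMr -scalerAl -scalerAr anti.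
  by rewrite scalerN opprK.
Qed.

End SolvablePairs.

(** Absorbs a sign into the group: -1 is the square of [g]. *)
Lemma cube_mulN (F : finFieldType) (u g h : FinGroup.clone {'GL_2[F]} _) :
    (val g * val g = -1 :> 'M_2)%R -> (val u = - (val g * val h) :> 'M_2)%R ->
  u = (g * g * (g * h))%g.
Proof. by move=> gg eu; apply: val_inj; rewrite eu !valGM gg mulN1r. Qed.

(** * Solvable pairs of a unipotent and a traceless element *)

Section UnipotentPairs.
Local Open Scope group_scope.
Local Open Scope ring_scope.
Variable F : finFieldType.
Local Notation GL2 := (FinGroup.clone {'GL_2[F]} _).
Hypothesis char3 : 3%:R = 0 :> F.
Hypothesis nsqN1 : forall a : F, a ^+ 2 != -1.
Implicit Types (A B K M N X Y Z : 'M[F]_2) (a b c d s t al be : F).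
Implicit Types (g h u v w x y z : GL2) (H V : {group GL2}).

Variables (x y : GL2) (N : 'M[F]_2).
Hypotheses (Gx : x \in SL2 F) (Gy : y \in SL2 F) (ex : val x = 1 + N).
Hypotheses (trN : \tr N = 0) (detN : \det N = 0) (nN : N != 0).
Hypothesis tr_y : \tr (val y) = 0.

Let NN : N * N = 0. Proof. by rewrite tr0_sqr // detN oppr0 raddf0. Qed.
Let yy : val y * val y = -1 :> 'M_2.
Proof. by rewrite tr0_det1_sqr // SL2_det. Qed.

(** No common [X] exists: a nilpotent one would give [y] an eigenvalue of square -1, and an
    invertible one would have the singular [N] as a nonzero multiple. The quaternion layer
    remains. *)
Lemma unipotent_solvable_trace :
  solvable <<[set x; y]>> -> (\tr (val y * N)) ^+ 2 = 1.
Proof.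
move=> sol; have h2 := two_neq0 char3.
have dx := SL2_det_neq0 Gx.
have trx : \tr (val x) = 2%:R by rewrite ex raddfD /= trN addr0 mxtrace1.
have sH : <<[set x; y]>> \subset SL2 F.
  by rewrite gen_subG; apply/subsetP=> z /set2P[]->.
have Hx : x \in <<[set x; y]>> by rewrite mem_gen ?set21.
have Hy : y \in <<[set x; y]>> by rewrite mem_gen ?set22.
case: (solvable_SL2_cases char3 sH sol).
- exists y => //; apply: tr0_nonscalar => //.
  exact/det_neq0/SL2_det_neq0.
- case=> X [tX nX cX].
  have [t et] := cX y Hy; have [s es] := cX x Hx.
  have [dX|dX] := eqVneq (\det X) 0.
    have XX : X * X = 0 by rewrite tr0_sqr // dX oppr0 raddf0.
    have [|r er] := @nilp_eigen _ X (val y) nX XX.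
      by rewrite et -scalerAl -mulrA XX mulr0 scaler0.
    have /eqP: (r ^+ 2 + 1) *: X = 0.
      rewrite scalerDl scale1r expr2 -scalerA -er scalerAr -er mulrA yy.
      by rewrite mulN1r addNr.
    by rewrite scaler_eq0 (negPf nX) orbF addr_eq0 (negPf (nsqN1 r)).
  have NX : N * X = X * N.
    case: (scaled_comm_pm es dX dx); last first.
      move/anti_sym/(anti_tr0 char3)/(_ dX); rewrite trx => /eqP.
      by rewrite (negPf h2).
    by rewrite ex mulrDr mulrDl mulr1 mul1r => /addrI.
  have [r er] := comm_tr0 char3 NX trN tX nX.
  have /eqP := detN; rewrite er detZ mulf_eq0 (negPf dX) orbF expf_eq0 /= => /eqP r0.
  by case/negP: nN; rewrite er r0 scale0r.
- case=> V [a [b [nV Va Vb ab cV]]].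
  exact: (layer_unipotent char3 nsqN1 sH nV Va Vb ab cV Hx Hy ex).
Qed.

(** The element [x] has order 3 and permutes [y], [w], [u] cyclically; the trace condition makes
    these anticommute pairwise. So [y] and [w] generate a quaternion group normalised by [x], as in
    SL(2, 3). *)
Lemma trace_unipotent_solvable :
  (\tr (val y * N)) ^+ 2 = 1 -> solvable <<[set x; y]>>.
Proof.
move=> tau2; set w := (y ^ x)%g; set u := (w ^ x)%g.
have inv := unip_mulV NN.
have eV : val (x^-1)%g = 1 - N.
  by apply: (mx2_mulI (SL2_det_neq0 Gx)); rewrite -valGM mulgV ex inv.
have ew : val w = (1 - N) * (val y * (1 + N)).
  by rewrite /w conjgE !valGM eV ex.
have Gw : w \in SL2 F by rewrite groupJ.
have trw : \tr (val w : 'M_2) = 0 by rewrite tr_valGJ.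
have yw : val y * val w = - (val w * val y).
  apply/eqP; rewrite -addr_eq0 tr0_anticomm // ew.
  rewrite tr_mul_conj_unip // SL2_det // detN tau2 mulr0 mul0rn subr0.
  by rewrite (_ : 1 *+ 2 + 1 = 3%:R) ?char3 ?oppr0 ?raddf0 // -mulrSr.
have x3 : (x * x * x)%g = 1%g.
  apply: val_inj; rewrite !valGM ex valG1.
  have -> : (1 + N) * (1 + N) = 1 + N *+ 2.
    by rewrite mulrDl !mulrDr !mulr1 mul1r NN addr0 -addrA mulr2n.
  rewrite mulrDl mul1r mulrDr mulr1 mulrnAl NN mul0rn addr0 -addrA -mulrS.
  by rewrite -scaler_nat char3 scale0r addr0.
have wu : val w * val u = - (val u * val w) := antiJ x yw.
have ux : (u ^ x)%g = y by rewrite -!conjgM mulgA x3 conjg1.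
have uy : val u * val y = - (val y * val u).
  by have := antiJ x wu; rewrite ux -/u.
have Gu : u \in SL2 F by rewrite groupJ.
have eu : val u = val y * val w \/ val u = - (val y * val w).
  have dyw : \det (val y * val w) = 1 by rewrite detM !SL2_det ?mulr1.
  apply: (anti_pair_pm char3 yw (SL2_det Gy) (SL2_det Gw) (SL2_det Gu) dyw uy
    (anti_sym wu)).
  - by rewrite -mulrA (anti_sym yw) mulrN.
  - by rewrite (mulrA (val w)) (anti_sym yw) mulNr opprK.
have ww : val w * val w = -1 :> 'M_2 by rewrite tr0_det1_sqr // SL2_det.
have eVw : val (w^-1)%g = - val w.
  by apply: (mx2_mulI (SL2_det_neq0 Gw)); rewrite -valGM mulgV mulrN ww opprK.
have wy : (w ^ y)%g = w^-1%g.
  by apply: val_inj; apply: valGJ_eq; rewrite eVw mulrN yw opprK.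
have ny : y \in 'N(<[w]>) by apply/normP; rewrite -cycleJ wy cycleV.
pose Q : {group GL2} := (<[w]> <*> <[y]>)%G.
have Qw : w \in Q := subsetP (joing_subl _ _) w (cycle_id w).
have Qy : y \in Q := subsetP (joing_subr _ _) y (cycle_id y).
have Qu : u \in Q.
  have Qyw := groupM Qy Qw.
  case: eu => e; first by rewrite (_ : u = y * w)%g //; apply: val_inj.
  have Qyyyw := groupM (groupM Qy Qy) Qyw.
  by rewrite (cube_mulN yy e).
apply: (solvable_gen2_norm (Q := Q)) => //.
  by apply: solvable_norm_joing ny; apply/abelian_sol/cycle_abelian.
rewrite inE conjYg -!cycleJ join_subG !cycle_subG.
by rewrite -[(w ^ x)%g]/u -[(y ^ x)%g]/w Qu Qw.
Qed.
End UnipotentPairs.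

(** * The quadratic space of traceless matrices *)

Section QuadraticSpace.
Local Open Scope ring_scope.
Variable F : finFieldType.
Hypothesis char3 : 3%:R = 0 :> F.
Hypothesis nsqN1 : forall a : F, a ^+ 2 != -1.
Implicit Types (A B K M N W X Y Z : 'M[F]_2) (a b c d s t al be : F).

(* For traceless M, Cayley-Hamilton gives M^2 = - det M, so that these are the
   traceless square roots of c. *)
Definition quadric c : {set 'M[F]_2} := [set M | (\tr M == 0) && (\det M == - c)].

Lemma quadricP c M : reflect (\tr M = 0 /\ \det M = - c) (M \in quadric c).
Proof. by rewrite inE; apply: (iffP andP) => -[/eqP t /eqP d]. Qed.

Lemma quadric_tr c M : M \in quadric c -> \tr M = 0.
Proof. by case/quadricP. Qed.

Lemma quadric_det c M : M \in quadric c -> \det M = - c.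
Proof. by case/quadricP. Qed.

Lemma quadric_sqr c M : M \in quadric c -> M * M = c%:M.
Proof. by case/quadricP=> tM dM; rewrite tr0_sqr // dM opprK. Qed.

Lemma scalar_mx2_inj : injective (fun a => a%:M : 'M[F]_2).
Proof. by move=> a b /matrixP/(_ 0 0); rewrite !mxE. Qed.

Lemma sqr_quadric c M : \tr M = 0 -> M * M = c%:M -> M \in quadric c.
Proof.
move=> tM; rewrite tr0_sqr // => /scalar_mx2_inj e.
by apply/quadricP; split=> //; rewrite -e opprK.
Qed.

Lemma quadric_opp c M : M \in quadric c -> - M \in quadric c.
Proof.
move=> /[dup] qM /quadric_sqr MM; apply: sqr_quadric.
  by rewrite raddfN /= (quadric_tr qM) oppr0.
by rewrite mulrNN.
Qed.

Lemma quadric_scale_pm c X Y t : c != 0 -> X \in quadric c -> Y \in quadric c ->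
  X = t *: Y -> X = Y \/ X = - Y.
Proof.
move=> nc /quadric_det dX /quadric_det dY e; move: dX.
rewrite e detZ dY mulrN => /oppr_inj/eqP; rewrite -{2}[c]mul1r.
rewrite (inj_eq (mulIf nc)) sqrf_eq1.
by case/orP=> /eqP->; rewrite ?scale1r ?scaleN1r; [left | right].
Qed.

Lemma orth_anti X Y : \tr X = 0 -> \tr Y = 0 -> \tr (X * Y) = 0 -> X * Y = - (Y * X).
Proof.
by move=> tX tY t; apply/eqP; rewrite -addr_eq0 tr0_anticomm // t raddf0.
Qed.

Lemma anti_orth X Y : X * Y = - (Y * X) -> \tr (X * Y) = 0.
Proof.
move=> e; apply/eqP; rewrite -(addrr_eq0 char3) {2}e raddfN /= -!mulmxE.
by rewrite mxtrace_mulC subrr.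
Qed.

(** If [X] has rows [(u, v)], [(w, -u)] and [Z] has rows [(p, m)], [(l, -p)], the conditions are
    [2 u p + v l + w m = 0] and [p ^+ 2 + m l = 1]. Each witness fixes some entries of [Z] and
    solves for the rest. *)
Lemma orth_quadric1 X : \tr X = 0 -> exists2 Z, Z \in quadric 1 & \tr (X * Z) = 0.
Proof.
have h2 := two_neq0 char3.
have det_q Z : \tr Z = 0 -> \det Z = -1 -> Z \in quadric 1.
  by move=> tZ dZ; apply/quadricP.
case/tr0_mx2=> u [v [w ->]].
have [w0|nw] := eqVneq w 0; last first.
  exists (mx2 1 (- 2%:R * u / w) 0 (- 1)); last by rewrite !mx2E; field.
  by apply: det_q; rewrite !mx2E; ring.
have [u0|nu] := eqVneq u 0.
  exists (mx2 1 0 0 (- 1)); last by rewrite w0 u0 !mx2E; ring.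
  by apply: det_q; rewrite !mx2E; ring.
pose r := - v / (2%:R * u).
exists (mx2 r (1 - r ^+ 2) 1 (- r)).
  by apply: det_q; rewrite !mx2E; ring.
rewrite w0 !mx2E /r; field.
by rewrite nu h2.
Qed.

Lemma quadric1_det X : X \in quadric 1 -> \det X != 0.
Proof. by move/quadric_det->; rewrite oppr_eq0 oner_neq0. Qed.

Section OrthogonalFrame.
Variables (c : F) (X Z : 'M[F]_2).
Hypotheses (qX : X \in quadric c) (qZ : Z \in quadric 1) (XZ0 : \tr (X * Z) = 0).

Let tX := quadric_tr qX.
Let tZ := quadric_tr qZ.
Let XZ : X * Z = - (Z * X). Proof. exact: orth_anti. Qed.
Let ZZ : Z * Z = 1. Proof. exact: (quadric_sqr qZ). Qed.
Let XX : X * X = c%:M. Proof. exact: (quadric_sqr qX). Qed.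

(** [X], [Z] and [X * Z] form an orthogonal frame, like the units of a quaternion algebra. *)
Lemma frame_prod : X * Z \in quadric (- c).
Proof.
apply: sqr_quadric => //.
rewrite {1}XZ mulNr -mulrA (mulrA X) XX scalarMl -scalerAr ZZ.
by rewrite -[1]/(1%:M) scalemx1 raddfN.
Qed.

Lemma frame_prod_anti : X * (X * Z) = - ((X * Z) * X).
Proof. by rewrite [in LHS]XZ mulrN mulrA. Qed.

(** [Y] anticommutes with [X * Z] and with [Z], hence commutes with their product [X]. *)
Lemma frame_orth Y : \tr Y = 0 -> X != 0 ->
  \tr (Y * Z) = 0 -> \tr (Y * (X * Z)) = 0 -> exists t, Y = t *: X.
Proof.
move=> tY nX YZ YXZ.
have aZ := orth_anti tY tZ YZ; have aW := orth_anti tY (quadric_tr frame_prod) YXZ.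
have eX : X = X * Z * Z by rewrite -mulrA ZZ mulr1.
apply: comm_tr0 => //.
rewrite [in LHS]eX mulrA aW mulNr -(mulrA (X * Z)) aZ mulrN opprK.
by rewrite mulrA -eX.
Qed.

End OrthogonalFrame.

(** The plane orthogonal to [N] contains [Z] and [Z + N], both of square 1, so [X] is orthogonal to
    [Z] and [N]. Then [X * N] is a multiple of [Z], and vanishes because its determinant does. *)
Lemma nilp_orth N X : N \in quadric 0 -> N != 0 -> \tr X = 0 ->
    (forall M, M \in quadric 1 -> \tr (N * M) = 0 -> \tr (X * M) = 0) ->
  exists t, X = t *: N.
Proof.
move=> qN nN tX H; have tN := quadric_tr qN.
have NN : N * N = 0 by rewrite (quadric_sqr qN) raddf0.
have [Z qZ NZ] := orth_quadric1 tN; have tZ := quadric_tr qZ.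
have ZZ : Z * Z = 1 := quadric_sqr qZ.
have aNZ := orth_anti tN tZ NZ.
have qZN : Z + N \in quadric 1.
  apply: sqr_quadric; first by rewrite raddfD /= tZ tN addr0.
  by rewrite mulrDl !mulrDr NN aNZ ZZ addr0 addrK.
have XZ := H Z qZ NZ.
have XN : \tr (X * N) = 0.
  have := H _ qZN; rewrite !mulrDr NN addr0 NZ raddfD /= XZ add0r; exact.
have aXZ := orth_anti tX tZ XZ; have aXN := orth_anti tX tN XN.
have cXNZ : (X * N) * Z = Z * (X * N).
  by rewrite -mulrA aNZ mulrN (mulrA X) aXZ mulNr opprK mulrA.
have nZ : Z != 0 := det_neq0 (quadric1_det qZ).
have [t et] := comm_tr0 char3 cXNZ XN tZ nZ.
have XN0 : X * N = 0.
  have /eqP := congr1 determinant et.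
  rewrite detM detZ (quadric_det qN) oppr0 mulr0 eq_sym mulf_eq0.
  rewrite (negPf (quadric1_det qZ)) orbF expf_eq0 /= => /eqP t0.
  by rewrite et t0 scale0r.
apply: comm_tr0 => //; rewrite XN0; apply: oppr_inj.
by rewrite oppr0 -aXN XN0.
Qed.

Section SplitFrame.
Variables (M0 Z : 'M[F]_2).
Hypotheses (qM : M0 \in quadric 1) (qZ : Z \in quadric 1) (MZ : \tr (M0 * Z) = 0).
Let tM := quadric_tr qM.
Let tZ := quadric_tr qZ.
Let ZZ : Z * Z = 1 := quadric_sqr qZ.
Let W := M0 * Z.
Let tW : \tr W = 0. Proof. exact: MZ. Qed.

(* The two isotropic lines of the hyperbolic plane orthogonal to M0. *)
Let isotropic s : s = 1 \/ s = -1 -> forall r, r = 1 \/ r = -1 ->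
  M0 + r *: (Z + s *: W) \in quadric 1 /\ \tr (M0 * (M0 + r *: (Z + s *: W))) = 2%:R.
Proof.
move=> es r er.
have qW := frame_prod qM qZ MZ; have WW := quadric_sqr qW.
have aMZ := orth_anti tM tZ MZ.
have aMW := frame_prod_anti qM qZ MZ.
have aZW : Z * W = - (W * Z).
  by rewrite /W mulrA -[in RHS]mulrA ZZ mulr1; apply: oppr_inj;
     rewrite opprK -mulNr -aMZ -mulrA ZZ mulr1.
have s2 : s * s = 1 by case: es => ->; rewrite ?mulrNN mulr1.
pose N := r *: (Z + s *: W).
have NN : N * N = 0.
  have e0 : (Z + s *: W) * (Z + s *: W) = 0.
    rewrite mulrDl !mulrDr -!scalerAl -!scalerAr aZW ZZ WW.
    by rewrite scalerA s2 scale1r scalerN addrA subrK raddfN subrr.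
  by rewrite /N -scalerAl -scalerAr e0 !scaler0.
have aMN : M0 * N = - (N * M0).
  rewrite /N -scalerAl -scalerAr mulrDl mulrDr -scalerAl -scalerAr aMZ aMW.
  by rewrite scalerN -opprD scalerN.
have tMN := anti_orth aMN.
rewrite -/N; split; last first.
  by rewrite mulrDr raddfD /= tMN addr0 (quadric_sqr qM) mxtrace_scalar.
apply: sqr_quadric.
  by rewrite raddfD /= tM linearZ /= raddfD /= linearZ /= tZ tW mulr0 addr0 mulr0 addr0.
by rewrite mulrDl !mulrDr NN aMN addr0 (quadric_sqr qM) subrK.
Qed.

Let orthE X : \tr (X * (Z + 1 *: W)) = 0 -> \tr (X * (Z + (-1) *: W)) = 0 ->
  \tr (X * Z) = 0 /\ \tr (X * W) = 0.
Proof.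
rewrite scale1r scaleN1r mulrDr mulrBr raddfD raddfB /= => e1 e2.
have /eqP : \tr (X * Z) + \tr (X * Z) = 0 by rewrite -(addr0 0) -{1}e1 -e2; ring.
rewrite (addrr_eq0 char3) => /eqP z; split=> //.
by move: e1; rewrite z add0r.
Qed.

Let four1 : 2%:R ^+ 2 = 1 :> F.
Proof. by apply: (eq_mod3 char3 (e := 1)); ring. Qed.

(** [M0] and its translates by the isotropic [Z + W] and [Z - W] span the space, and each pairs with
    [M0] to 2, whose square is 1. *)
Lemma split_frame_orth X : \tr X = 0 ->
    (forall M, M \in quadric 1 -> (\tr (M0 * M)) ^+ 2 = 1 -> \tr (X * M) = 0) ->
  X = 0.
Proof.
move=> tX H.
have XM : \tr (X * M0) = 0.
  by apply: H => //; rewrite (quadric_sqr qM) mxtrace_scalar four1.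
have XN s : s = 1 \/ s = -1 -> \tr (X * (Z + s *: W)) = 0.
  move=> es; have [q e] := isotropic es (or_introl (erefl 1)).
  have := H _ q; rewrite e four1 mulrDr raddfD /= XM add0r scale1r; exact.
have [XZ XW] := orthE (XN _ (or_introl (erefl _))) (XN _ (or_intror (erefl _))).
have aM := orth_anti tX tM XM; have aZ := orth_anti tX tZ XZ.
have aW := orth_anti tX tW XW.
have cW : X * W = W * X.
  by rewrite /W (mulrA X) aM mulNr -(mulrA M0 X Z) aZ mulrN opprK mulrA.
have : W * X = 0 by apply: (mx_addrr_eq0 char3); rewrite -{1}cW aW addNr.
rewrite -[in RHS](mulr0 W); apply: mx2_mulI.
by rewrite detM mulf_neq0 // quadric1_det.
Qed.

(** If [p] and [r] are the pairings of [X] with [M0] and an isotropic vector, then [p], [p + r] and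
    [p - r] have square 1, which forces [r = 0]. So [X] is orthogonal to [Z] and [W]. *)
Lemma split_frame_eq X : X \in quadric 1 ->
    (forall M, M \in quadric 1 -> (\tr (M0 * M)) ^+ 2 = 1 -> (\tr (X * M)) ^+ 2 = 1) ->
  X = M0 \/ X = - M0.
Proof.
move=> qX H; have tX := quadric_tr qX.
have XM : (\tr (X * M0)) ^+ 2 = 1.
  by apply: H => //; rewrite (quadric_sqr qM) mxtrace_scalar four1.
have XN s : s = 1 \/ s = -1 -> \tr (X * (Z + s *: W)) = 0.
  move=> es; have [q e] := isotropic es (or_introl (erefl 1)).
  have [q' e'] := isotropic es (or_intror (erefl (-1))).
  have := H _ q; rewrite e four1 mulrDr raddfD /= scale1r => /(_ erefl).
  have := H _ q'; rewrite e' four1 mulrDr raddfD /= scaleN1r mulrN raddfN /=.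
  move=> /(_ erefl); move: XM; move: (\tr (X * M0)) (\tr (X * (Z + s *: W))).
  move=> p r e1 e2 e3; apply/eqP; rewrite -[_ == 0](expf_eq0 _ 2).
  apply/eqP/(mulfI (two_neq0 char3)); rewrite mulr0.
  have -> : 2%:R * r ^+ 2 = (p + r) ^+ 2 + (p - r) ^+ 2 - 2%:R * p ^+ 2 by ring.
  by rewrite e1 e2 e3; ring.
have [XZ XW] := orthE (XN _ (or_introl (erefl _))) (XN _ (or_intror (erefl _))).
have nM : M0 != 0 := det_neq0 (quadric1_det qM).
have [t et] := frame_orth qM qZ MZ tX nM XZ XW.
exact: (quadric_scale_pm (oner_neq0 F) qX qM et).
Qed.
End SplitFrame.
End QuadraticSpace.

(** * The solvabilizers of SL(2, q) *)

Section Families.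
Local Open Scope group_scope.
Local Open Scope ring_scope.
Variable F : finFieldType.
Local Notation GL2 := (FinGroup.clone {'GL_2[F]} _).
Hypothesis char3 : 3%:R = 0 :> F.
Hypothesis nsqN1 : forall a : F, a ^+ 2 != -1.
Implicit Types (A B K M N W X Y Z : 'M[F]_2) (a b c d s t al be : F).
Implicit Types (g h x y : GL2).

Definition SolM A : {set {'GL_2[F]}} := Sol (SL2 F) (gl A).

Definition affine al be M : 'M[F]_2 := al%:M + be *: M.

Definition linked A M := \det (A * M - M * A) = 0 \/ A * M = - (M * A).

Lemma det_affine_quadric al be d M : M \in quadric d ->
  \det (affine al be M) = al ^+ 2 - be ^+ 2 * d.
Proof. by case/quadricP=> tM dM; rewrite det_affine // dM mulrN. Qed.

Lemma SolM_sym A B : \det A = 1 -> \det B = 1 ->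
  (gl A \in SolM B) = (gl B \in SolM A).
Proof. by move=> dA dB; apply: Sol_sym; apply: gl_SL2. Qed.

Lemma mem_SolM A : \det A = 1 -> gl A \in SolM A.
Proof. by move=> dA; apply/Sol_self/gl_SL2. Qed.

Lemma eq_SolM A B :
    (forall g, g \in SL2 F -> g \in SolM A <-> g \in SolM B) -> SolM A = SolM B.
Proof.
have sub (C : 'M[F]_2) g : g \in SolM C -> g \in SL2 F by rewrite !inE => /andP[].
move=> H; apply/setP=> g; apply/idP/idP=> Sg; have [AB BA] := H g (sub _ _ Sg).
  exact: AB.
exact: BA.
Qed.

Section Regular.
Variables (d al be : F).
Hypotheses (nd : d != 0) (nal : al != 0) (nbe : be != 0).
Hypothesis unimod : al ^+ 2 - be ^+ 2 * d = 1.

Lemma det_regular M : M \in quadric d -> \det (affine al be M) = 1.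
Proof. by move=> qM; rewrite (det_affine_quadric _ _ qM). Qed.

Lemma mem_SolM_regular M g : M \in quadric d -> g \in SL2 F ->
  g \in SolM (affine al be M) <-> linked (val g) M.
Proof.
move=> qM Gg; have [tM dM] := quadricP _ _ qM; have dA := det_regular qM.
have ndM : \det M != 0 by rewrite dM oppr_eq0.
have := regular_solvable char3 nsqN1 Gg (gl_SL2 dA) (val_gl dA) tM ndM nal nbe.
by rewrite setUC inE Gg.
Qed.

Lemma SolM_regular_opp M : M \in quadric d ->
  SolM (affine al be (- M)) = SolM (affine al be M).
Proof.
move=> qM; have qN := quadric_opp qM; apply: eq_SolM => g Gg.
have H1 := mem_SolM_regular qM Gg; have H2 := mem_SolM_regular qN Gg.
split=> [/H2 H | /H1 H]; [apply/H1 | apply/H2].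
  case: H => // e; [left | right].
    move: e; rewrite mulrN mulNr -opprD -scaleN1r detZ => /eqP.
    by rewrite mulf_eq0 expf_eq0 oppr_eq0 oner_eq0 /= => /eqP.
  by apply: oppr_inj; rewrite -mulrN e mulNr.
case: H => // e; [left | right].
  by rewrite mulrN mulNr -opprD -scaleN1r detZ e mulr0.
by rewrite mulrN mulNr e.
Qed.

End Regular.

(** The criterion [linked] involves [M] alone, so one choice of coefficients serves for each type of
    torus. *)
Lemma SolM_regular_eq d al be al' be' M : d != 0 -> al != 0 -> be != 0 ->
    al ^+ 2 - be ^+ 2 * d = 1 -> al' != 0 -> be' != 0 ->
    al' ^+ 2 - be' ^+ 2 * d = 1 -> M \in quadric d ->
  SolM (affine al be M) = SolM (affine al' be' M).
Proof.
move=> nd na nb e na' nb' e' qM; apply: eq_SolM => g Gg.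
have H1 := mem_SolM_regular nd na nb e qM Gg.
have H2 := mem_SolM_regular nd na' nb' e' qM Gg.
by split=> [/H1/H2 | /H2/H1].
Qed.

(** The commutator is singular when the Gram determinant vanishes, where [4 c d = c d];
    anticommutation forces trace zero, hence [a = 0], and orthogonality. *)
Lemma linked_affine a b c d X M : b != 0 -> d != 0 -> X \in quadric c ->
    M \in quadric d ->
  linked (affine a b X) M <->
  (\tr (X * M)) ^+ 2 = c * d \/ (a = 0 /\ \tr (X * M) = 0).
Proof.
move=> nb nd qX qM; have [tX dX] := quadricP _ _ qX; have [tM dM] := quadricP _ _ qM.
have ndM : \det M != 0 by rewrite dM oppr_eq0.
have eK : affine a b X * M - M * affine a b X = b *: (X * M - M * X).
  rewrite /affine mulrDl mulrDr scalarMl scalarMr -scalerAl -scalerAr.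
  by rewrite opprD addrACA subrr add0r scalerBr.
have dK : \det (X * M - M * X) = c * d - (\tr (X * M)) ^+ 2.
  rewrite det_commutator_tr0 // dX dM mulrNN; congr (_ - _).
  by apply: (eq_mod3 char3 (e := c * d)); ring.
rewrite /linked eK detZ dK; split.
  case=> [/eqP e|e].
    by left; move: e; rewrite mulf_eq0 expf_eq0 (negPf nb) /= subr_eq0 => /eqP.
  right; have a0 : a = 0.
    have := anti_tr0 char3 e ndM; rewrite raddfD /= linearZ /= tX mulr0 addr0.
    by rewrite mxtrace_scalar mulr2n => /eqP; rewrite (addrr_eq0 char3) => /eqP.
  split=> //; apply: (anti_orth char3); apply: (scalerI nb).
  by move: e; rewrite /affine a0 raddf0 add0r -scalerAl -scalerAr scalerN.
case=> [->|[a0 t0]]; [left | right]; first by rewrite subrr mulr0.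
rewrite /affine a0 raddf0 add0r -scalerAl -scalerAr -scalerN.
by rewrite (orth_anti tX tM t0).
Qed.

Variables (al2 be2 al3 be3 : F).
Hypotheses (nal2 : al2 != 0) (nbe2 : be2 != 0) (nal3 : al3 != 0) (nbe3 : be3 != 0).
Hypothesis unimod2 : al2 ^+ 2 - be2 ^+ 2 * -1 = 1.
Hypothesis unimod3 : al3 ^+ 2 - be3 ^+ 2 * 1 = 1.

Let nN1 : -1 != 0 :> F. Proof. by rewrite oppr_eq0 oner_neq0. Qed.

Definition probe M := gl (affine al3 be3 M).

(** Solvabilizers are symmetric, so the criterion for the regular probe applies whatever the type of
    [X]. *)
Lemma probe_mem a b c X M : b != 0 -> X \in quadric c -> a ^+ 2 - b ^+ 2 * c = 1 ->
    M \in quadric 1 ->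
  probe M \in SolM (affine a b X) <->
  (\tr (X * M)) ^+ 2 = c \/ (a = 0 /\ \tr (X * M) = 0).
Proof.
move=> nb qX e qM; have dA : \det (affine a b X) = 1 by rewrite (det_affine_quadric _ _ qX).
rewrite SolM_sym //; last exact: (det_regular unimod3).
have H := mem_SolM_regular (oner_neq0 F) nal3 nbe3 unimod3 qM (gl_SL2 dA).
rewrite val_gl // in H; have H' := linked_affine a nb (oner_neq0 F) qX qM.
by rewrite mulr1 in H'; apply: iff_trans H H'.
Qed.

Lemma affine_inv X : X = affine 0 1 X.
Proof. by rewrite /affine raddf0 add0r scale1r. Qed.

Lemma affine_unip N : 1 + N = affine 1 1 N.
Proof. by rewrite /affine scale1r. Qed.

Let unimod_inv : 0 ^+ 2 - 1 ^+ 2 * -1 = 1 :> F. Proof. by ring. Qed.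
Let unimod_unip : 1 ^+ 2 - 1 ^+ 2 * 0 = 1 :> F. Proof. by ring. Qed.

Lemma probe_one M : M \in quadric 1 -> probe M \in SolM 1.
Proof.
move=> qM; rewrite SolM_sym ?det1 ?(det_regular unimod3) //.
have -> : gl (1 : 'M[F]_2) = 1%g by apply: val_inj; rewrite val_gl ?det1.
by rewrite inE group1 /= setUC; have := Sol1 (SL2 F) => /setP/(_ (probe M));
   rewrite inE gl_SL2 ?(det_regular unimod3).
Qed.

Lemma probe_inv X M : X \in quadric (-1) -> M \in quadric 1 ->
  probe M \in SolM X <-> \tr (X * M) = 0.
Proof.
move=> qX qM; have := probe_mem (oner_neq0 F) qX unimod_inv qM.
rewrite -affine_inv => H; apply: (iff_trans H).
split=> [[/eqP|[]//]|]; last by right.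
by rewrite (negPf (nsqN1 _)).
Qed.

Lemma probe_nonsplit X M : X \in quadric (-1) -> M \in quadric 1 ->
  probe M \notin SolM (affine al2 be2 X).
Proof.
move=> qX qM; apply/negP=> /(probe_mem nbe2 qX unimod2 qM)[/eqP|[/eqP]].
  by rewrite (negPf (nsqN1 _)).
by rewrite (negPf nal2).
Qed.

Lemma probe_split X M : X \in quadric 1 -> M \in quadric 1 ->
  probe M \in SolM (affine al3 be3 X) <-> (\tr (X * M)) ^+ 2 = 1.
Proof.
move=> qX qM; apply: (iff_trans (probe_mem nbe3 qX unimod3 qM)).
split=> [[//|[/eqP]]|]; last by left.
by rewrite (negPf nal3).
Qed.

Lemma probe_unip N M : N \in quadric 0 -> M \in quadric 1 ->
  probe M \in SolM (1 + N) <-> \tr (N * M) = 0.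
Proof.
move=> qN qM; rewrite affine_unip.
apply: (iff_trans (probe_mem (oner_neq0 F) qN unimod_unip qM)).
split=> [[/eqP|[/eqP]]|->]; last by left; rewrite expr0n.
  by rewrite expf_eq0 => /eqP.
by rewrite oner_eq0.
Qed.

Lemma orth_all_quadric1 X : \tr X = 0 ->
  (forall M, M \in quadric 1 -> \tr (X * M) = 0) -> X = 0.
Proof.
move=> tX H; have [M qM _] := orth_quadric1 char3 tX.
have [Z qZ MZ] := orth_quadric1 char3 (quadric_tr qM).
by apply: (split_frame_orth char3 qM qZ MZ tX) => Y qY _; apply: H.
Qed.

Lemma orth_split M0 X : M0 \in quadric 1 -> \tr X = 0 ->
    (forall M, M \in quadric 1 -> (\tr (M0 * M)) ^+ 2 = 1 -> \tr (X * M) = 0) ->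
  X = 0.
Proof.
move=> qM tX H; have [Z qZ MZ] := orth_quadric1 char3 (quadric_tr qM).
exact: (split_frame_orth char3 qM qZ MZ tX).
Qed.

Lemma quadric_neq0 c X : c != 0 -> X \in quadric c -> X != 0.
Proof. by move=> nc /quadric_det dX; apply: det_neq0; rewrite dX oppr_eq0. Qed.

(** Types are told apart by the probes they accept: all for the identity, none for nonsplit
    elements, the orthogonal ones for involutions and unipotents, and those of pairing 1 or -1 for
    split elements. *)
Lemma one_neq_inv X : X \in quadric (-1) -> SolM 1 <> SolM X.
Proof.
move=> qX e; have /eqP := quadric_neq0 nN1 qX; apply.
apply: orth_all_quadric1 (quadric_tr qX) _ => M qM.
by apply/probe_inv; rewrite // -e probe_one.
Qed.

Lemma one_neq_unip N : N \in quadric 0 -> N != 0 -> SolM 1 <> SolM (1 + N).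
Proof.
move=> qN /eqP nN e; apply: nN; apply: orth_all_quadric1 (quadric_tr qN) _ => M qM.
by apply/probe_unip; rewrite // -e probe_one.
Qed.

Lemma one_neq_nonsplit X : X \in quadric (-1) -> SolM 1 <> SolM (affine al2 be2 X).
Proof.
move=> qX e; have [M qM _] := orth_quadric1 char3 (quadric_tr qX).
by have := probe_nonsplit qX qM; rewrite -e probe_one.
Qed.

Lemma one_neq_split X : X \in quadric 1 -> SolM 1 <> SolM (affine al3 be3 X).
Proof.
move=> qX e; have [M qM XM] := orth_quadric1 char3 (quadric_tr qX).
have := probe_one qM; rewrite e => /probe_split => /(_ qX qM).
by rewrite XM expr0n => /esym/eqP; rewrite oner_eq0.
Qed.

Lemma inv_neq_nonsplit X Y : X \in quadric (-1) -> Y \in quadric (-1) ->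
  SolM X <> SolM (affine al2 be2 Y).
Proof.
move=> qX qY e; have [M qM XM] := orth_quadric1 char3 (quadric_tr qX).
by have := probe_nonsplit qY qM; rewrite -e (iffRL (probe_inv qX qM)).
Qed.

Lemma unip_neq_nonsplit N Y : N \in quadric 0 -> Y \in quadric (-1) ->
  SolM (1 + N) <> SolM (affine al2 be2 Y).
Proof.
move=> qN qY e; have [M qM NM] := orth_quadric1 char3 (quadric_tr qN).
by have := probe_nonsplit qY qM; rewrite -e (iffRL (probe_unip qN qM)).
Qed.

Lemma split_neq_nonsplit X Y : X \in quadric 1 -> Y \in quadric (-1) ->
  SolM (affine al3 be3 X) <> SolM (affine al2 be2 Y).
Proof.
move=> qX qY e; have := probe_nonsplit qY qX; rewrite -e mem_SolM //.
exact: (det_regular unimod3).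
Qed.

(** All probes accepted by [Y] would be orthogonal to [X]; they span the space, so [X] would be
    zero. *)
Lemma inv_neq_split X Y : X \in quadric (-1) -> Y \in quadric 1 ->
  SolM X <> SolM (affine al3 be3 Y).
Proof.
move=> qX qY e; have /eqP := quadric_neq0 nN1 qX; apply.
apply: (orth_split qY (quadric_tr qX)) => M qM YM.
by apply/probe_inv; rewrite // e (iffRL (probe_split qY qM)).
Qed.

Lemma unip_neq_split N Y : N \in quadric 0 -> N != 0 -> Y \in quadric 1 ->
  SolM (1 + N) <> SolM (affine al3 be3 Y).
Proof.
move=> qN /eqP nN qY e; apply: nN; apply: (orth_split qY (quadric_tr qN)) => M qM YM.
by apply/probe_unip; rewrite // e (iffRL (probe_split qY qM)).
Qed.

(** Equality would put [X] on the isotropic line of [N]. *)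
Lemma inv_neq_unip X N : X \in quadric (-1) -> N \in quadric 0 -> N != 0 ->
  SolM X <> SolM (1 + N).
Proof.
move=> qX qN nN e.
have [|t et] := nilp_orth char3 qN nN (quadric_tr qX) _.
  by move=> M qM NM; apply/probe_inv; rewrite // e (iffRL (probe_unip qN qM)).
have /eqP := quadric_det qX; rewrite et detZ (quadric_det qN) oppr0 mulr0 opprK.
by rewrite eq_sym oner_eq0.
Qed.

(** The plane orthogonal to [Y] is spanned by [Z] and [Y * Z], both of square 1 and so usable as
    probes. *)
Lemma SolM_inv_inj X Y : X \in quadric (-1) -> Y \in quadric (-1) ->
  SolM X = SolM Y -> X = Y \/ X = - Y.
Proof.
move=> qX qY e; have [Z qZ YZ] := orth_quadric1 char3 (quadric_tr qY).
have nY := quadric_neq0 nN1 qY.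
have qYZ : Y * Z \in quadric 1 by have := frame_prod qY qZ YZ; rewrite opprK.
have YW : \tr (Y * (Y * Z)) = 0.
  by rewrite mulrA (quadric_sqr qY) scalarMl linearZ /= (quadric_tr qZ) mulr0.
have [||t et] := frame_orth char3 qY qZ YZ (quadric_tr qX) nY.
- by apply/probe_inv; rewrite // e (iffRL (probe_inv qY qZ)).
- by apply/probe_inv; rewrite // e (iffRL (probe_inv qY qYZ)).
exact: (quadric_scale_pm nN1 qX qY et).
Qed.

Lemma SolM_split_inj X Y : X \in quadric 1 -> Y \in quadric 1 ->
  SolM (affine al3 be3 X) = SolM (affine al3 be3 Y) -> X = Y \/ X = - Y.
Proof.
move=> qX qY e; have [Z qZ YZ] := orth_quadric1 char3 (quadric_tr qY).
apply: (split_frame_eq char3 qY qZ YZ qX) => M qM YM.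
by apply/probe_split; rewrite // e (iffRL (probe_split qY qM)).
Qed.

(** No probe is accepted here, so the regular element of [X] itself is tested against [Y]. Since
    [al2 != 0] there is no anticommutation, and a nonzero singular commutator would give [X] an
    eigenvalue of square -1. *)
Lemma SolM_nonsplit_inj X Y : X \in quadric (-1) -> Y \in quadric (-1) ->
  SolM (affine al2 be2 X) = SolM (affine al2 be2 Y) -> X = Y \/ X = - Y.
Proof.
move=> qX qY e; have dA := det_regular unimod2 qX.
have := mem_SolM dA; rewrite e.
move/(mem_SolM_regular nN1 nal2 nbe2 unimod2 qY (gl_SL2 dA)); rewrite val_gl //.
case; last first.
  move/(anti_tr0 char3); rewrite (quadric_det qY) opprK oner_neq0 => /(_ isT).
  rewrite raddfD /= linearZ /= (quadric_tr qX) mulr0 addr0 mxtrace_scalar mulr2n.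
  by move/eqP; rewrite (addrr_eq0 char3) (negPf nal2).
rewrite (_ : _ - _ = be2 *: (X * Y - Y * X)); last first.
  rewrite /affine mulrDl mulrDr scalarMl scalarMr -scalerAl -scalerAr.
  by rewrite opprD addrACA subrr add0r scalerBr.
rewrite detZ => /eqP; rewrite mulf_eq0 expf_eq0 (negPf nbe2) /= => /eqP dK.
have cXY : X * Y = Y * X.
  apply/eqP; rewrite -subr_eq0; apply/negPn/negP => nK.
  have [t et] := commutator_eigen nK dK.
  set K := X * Y - Y * X in nK et; have : X * (X * K) = t ^+ 2 *: K.
    by rewrite et -scalerAr et scalerA.
  rewrite mulrA (quadric_sqr qX) scalarMl => /eqP; rewrite -subr_eq0 -scalerBl.
  by rewrite scaler_eq0 (negPf nK) orbF subr_eq0 eq_sym (negPf (nsqN1 t)).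
have [t et] := comm_tr0 char3 cXY (quadric_tr qX) (quadric_tr qY) (quadric_neq0 nN1 qY).
exact: (quadric_scale_pm nN1 qX qY et).
Qed.

(** [Y] detects the scale of [N]: for nonzero [t], it forms a solvable pair with [1 + t N] exactly
    when [t ^+ 2 = 1]. *)
Lemma unip_partner N : N \in quadric 0 -> N != 0 ->
  exists2 Y, Y \in quadric (-1) & \tr (Y * N) = 1.
Proof.
move=> qN nN; have tN := quadric_tr qN; have := quadric_det qN; move: tN nN.
case/tr0_mx2=> u [v [w ->]] nN; rewrite mx2_det oppr0 => e.
have det_q Y : \tr Y = 0 -> \det Y = 1 -> Y \in quadric (-1).
  by move=> tY dY; apply/quadricP; rewrite opprK.
have [w0|nw] := eqVneq w 0.
  have u0 : u = 0.
    apply/eqP; rewrite -[_ == 0](expf_eq0 _ 2) -oppr_eq0; apply/eqP.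
    by rewrite -e w0; ring.
  have nv : v != 0.
    by apply: contraNneq nN => v0; rewrite u0 v0 w0 oppr0 -mx2_0.
  exists (mx2 0 (- v) v^-1 (- 0)); last by rewrite u0 w0 !mx2E; field.
  by apply: det_q; rewrite !mx2E; field.
have ev : v = - u ^+ 2 / w.
  by apply: (mulIf nw); rewrite divfK //; apply: (eq_of_sub (esym e)); ring.
exists (mx2 (- u) ((u ^+ 2 + 1) / w) (- w) (- - u)).
  by apply: det_q; rewrite !mx2E; field.
by rewrite ev !mx2E; field.
Qed.

Lemma SolM_unip_inj N N' : N \in quadric 0 -> N != 0 -> N' \in quadric 0 -> N' != 0 ->
  SolM (1 + N) = SolM (1 + N') -> N = N' \/ N = - N'.
Proof.
move=> qN nN qN' nN' e.
have [|t et] := nilp_orth char3 qN' nN' (quadric_tr qN) _.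
  by move=> M qM NM; apply/probe_unip; rewrite // e (iffRL (probe_unip qN' qM)).
have [Y qY YN] := unip_partner qN' nN'.
have dY : \det Y = 1 by rewrite (quadric_det qY) opprK.
have d1 M : M \in quadric 0 -> \det (1 + M) = 1.
  by move=> qM; rewrite affine_unip (det_affine_quadric _ _ qM) unimod_unip.
have d0 M : M \in quadric 0 -> \det M = 0 by move/quadric_det->; rewrite oppr0.
have vY := val_gl dY; have GY := gl_SL2 dY.
have tY : \tr (val (gl Y)) = 0 by rewrite vY (quadric_tr qY).
have S' : gl Y \in SolM (1 + N').
  rewrite inE GY /=.
  apply: (trace_unipotent_solvable char3 (gl_SL2 (d1 _ qN')) GY (val_gl (d1 _ qN'))
            (quadric_tr qN') (d0 _ qN') tY).
  by rewrite vY YN expr1n.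
have : gl Y \in SolM (1 + N) by rewrite e.
rewrite inE => /andP[_ sol].
have := unipotent_solvable_trace char3 nsqN1 (gl_SL2 (d1 _ qN)) GY (val_gl (d1 _ qN))
  (quadric_tr qN) (d0 _ qN) nN tY sol.
rewrite vY et -scalerAr linearZ /= YN mulr1 => /eqP; rewrite sqrf_eq1.
by case/orP=> /eqP->; rewrite ?scale1r ?scaleN1r; [left | right].
Qed.

(** [1 - N] is the inverse of [1 + N]. *)
Lemma SolM_unip_opp N : N \in quadric 0 -> SolM (1 - N) = SolM (1 + N).
Proof.
move=> qN; rewrite /SolM -[RHS]SolV; congr (Sol _ _).
have d1 M : M \in quadric 0 -> \det (1 + M) = 1.
  by move=> qM; rewrite affine_unip (det_affine_quadric _ _ qM) unimod_unip.
apply: val_inj; rewrite (val_gl (d1 _ (quadric_opp qN))).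
apply: (mx2_mulI (SL2_det_neq0 (gl_SL2 (d1 _ qN)))).
rewrite -valGM mulgV valG1 val_gl ?d1 //.
by rewrite unip_mulV // (quadric_sqr qN) raddf0.
Qed.

End Families.

(** * Counting *)

Section Counting.
Local Open Scope ring_scope.
Variable F : finFieldType.
Hypothesis char3 : 3%:R = 0 :> F.
Implicit Types (A B M N X Y : 'M[F]_2) (a b c d : F).

(** In [u ^+ 2 + v * w = c], a nonzero [w] determines [v] from [u] (map [f1]), while [w = 0] leaves
    [v] free and asks [u ^+ 2 = c] (map [f0]). *)
Lemma card_quadric c :
  #|quadric c| = (#|F| * #|F|.-1 + #|[set u : F | u ^+ 2 == c]| * #|F|)%N.
Proof.
pose f1 (p : F * F) := mx2 p.1 ((c - p.1 ^+ 2) / p.2) p.2 (- p.1).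
pose f0 (p : F * F) := mx2 p.1 p.2 0 (- p.1).
pose A1 := setX [set: F] [set~ 0 : F]; pose A0 := setX [set u : F | u ^+ 2 == c] [set: F].
have -> : quadric c = f1 @: A1 :|: f0 @: A0.
  apply/setP=> M; rewrite in_setU; apply/idP/orP=> [qM|].
    have := quadric_det qM; have := quadric_tr qM.
    case/tr0_mx2=> u [v [w ->]]; rewrite mx2_det => e.
    have {}e : u ^+ 2 + v * w = c by apply: oppr_inj; rewrite -e; ring.
    have [w0|nw] := eqVneq w 0; [right | left]; apply/imsetP.
      exists (u, v); last by rewrite /f0 w0.
      by rewrite in_setX !inE -e w0 mulr0 addr0 eqxx.
    exists (u, w); first by rewrite in_setX !inE nw.
    by rewrite /f1 /= -e; congr mx2; field.
  case=> /imsetP[[u v] Huv ->]; apply/quadricP; move: Huv; rewrite in_setX !inE /=.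
    by move=> nv; rewrite /f1 !mx2E /=; split; [ring | field].
  by rewrite andbT /f0 !mx2E /= => /eqP <-; split; ring.
rewrite cardsU (_ : _ :&: _ = set0); last first.
  apply/setP=> M; rewrite in_setI in_set0; apply/negP=> /andP[].
  case/imsetP=> [[u w] Huw ->] /imsetP[[u' v'] _ /mx2_inj[_ _ /= e _]].
  by move: Huw; rewrite in_setX !inE /= e eqxx.
rewrite cards0 subn0; congr (_ + _)%N.
  rewrite card_imset; last by move=> [u v] [u' v'] /mx2_inj[/= -> _ ->].
  by rewrite cardsX cardsT cardsC1.
rewrite card_imset; last by move=> [u v] [u' v'] /mx2_inj[/= -> ->].
by rewrite cardsX cardsT.
Qed.

(** Each fibre consists of [M] and [- M], distinct because 2 is invertible and 0 is excluded. *)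
Lemma card_imset_opp (T : finType) (f : 'M[F]_2 -> T) (D : {set 'M[F]_2}) :
    0 \notin D -> (forall M, M \in D -> - M \in D) ->
    (forall M, M \in D -> f (- M) = f M) ->
    (forall M N, M \in D -> N \in D -> f M = f N -> M = N \/ M = - N) ->
  (#|f @: D| * 2 = #|D|)%N.
Proof.
move=> D0 DN fN finj; rewrite -[RHS]sum1_card (partition_big_imset f) /=.
rewrite -sum_nat_const; apply: eq_bigr => _ /imsetP[M DM ->].
rewrite sum1dep_card (_ : [set x | _] = [set M; - M]).
  rewrite cards2; suff -> : M != - M by [].
  apply: contraNneq D0 => e; rewrite (_ : 0 = M) //.
  by apply/esym/(mx_addrr_eq0 char3); rewrite {1}e addNr.
apply/setP=> N; rewrite !inE; apply/andP/orP=> [[DN' /eqP e]|].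
  by case: (finj _ _ DN' DM e) => ->; [left | right].
by case=> /eqP->; split=> //; rewrite ?DN ?fN.
Qed.

End Counting.

(** * Classification and number of the solvabilizers *)

Section CardSolv.
Local Open Scope ring_scope.
Variable F : finFieldType.
Hypothesis char3 : 3%:R = 0 :> F.
Hypothesis nsqN1 : forall a : F, a ^+ 2 != -1.
Hypothesis sqr_or_opp : forall c : F, c != 0 ->
  exists2 b, b != 0 & c = b ^+ 2 \/ c = - b ^+ 2.
Variables (al2 be2 al3 be3 : F).
Hypotheses (nal2 : al2 != 0) (nbe2 : be2 != 0) (nal3 : al3 != 0) (nbe3 : be3 != 0).
Hypothesis unimod2 : al2 ^+ 2 - be2 ^+ 2 * -1 = 1.
Hypothesis unimod3 : al3 ^+ 2 - be3 ^+ 2 * 1 = 1.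
Implicit Types (A B M N X Y : 'M[F]_2) (a b c d : F).

Let nN1 : -1 != 0 :> F. Proof. by rewrite oppr_eq0 oner_neq0. Qed.

Definition inv_family := (@SolM F) @: quadric (-1).
Definition nonsplit_family := (fun M => SolM (affine al2 be2 M)) @: quadric (-1).
Definition split_family := (fun M => SolM (affine al3 be3 M)) @: quadric 1.
Definition unip_family := (fun N : 'M[F]_2 => SolM (1 + N)) @: (quadric 0 :\ 0).

Lemma SolM_opp A : \det A = 1 -> SolM (- A) = SolM A.
Proof. exact: Sol_gl_opp. Qed.

Lemma det_inv X : X \in quadric (-1) -> \det X = 1.
Proof. by move/quadric_det->; rewrite opprK. Qed.

Lemma det_unip N : N \in quadric 0 -> \det (1 + N) = 1.
Proof.
move=> qN; rewrite affine_unip (det_affine_quadric _ _ qN).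
by rewrite expr1n mulr0 subr0.
Qed.

(** Write [A = a + X] with [X] traceless of square [c]. The type depends on whether [c] is zero, a
    nonzero square [b ^+ 2] or its opposite, and in the last case on whether [a = 0]; dividing [X]
    by [b] normalises [c] to 1 or -1. *)
Lemma SolM_cases A : \det A = 1 ->
  SolM A \in [set SolM (1 : 'M[F]_2)] :|: inv_family :|: nonsplit_family
             :|: split_family :|: unip_family.
Proof.
move=> dA; rewrite !inE; have h2 := two_neq0 char3.
pose a := \tr A / 2%:R; pose X := A - a%:M.
have eA : A = affine a 1 X by rewrite /affine scale1r addrC subrK.
have tX : \tr X = 0.
  by rewrite raddfB /= mxtrace_scalar -(mulr_natr a) divfK // subrr.
have [c qX] : exists c, X \in quadric c.
  by exists (- \det X); apply/quadricP; rewrite opprK.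
have e : a ^+ 2 - c = 1.
  by rewrite -dA eA (det_affine_quadric _ _ qX) expr1n mul1r.
have [X0|nX] := eqVneq X 0.
  have c0 : c = 0 by apply: oppr_inj; rewrite -(quadric_det qX) X0 det0 oppr0.
  move/eqP: e; rewrite c0 subr0 sqrf_eq1 => /orP[]/eqP a1.
    by rewrite eA X0 /affine a1 scaler0 addr0 eqxx.
  rewrite eA X0 /affine a1 scaler0 addr0 raddfN /=.
  by rewrite -[1%:M]/(1 : 'M[F]_2) SolM_opp ?det1 ?eqxx.
have [c0|nc] := eqVneq c 0.
  rewrite c0 in qX; apply/orP; right.
  move/eqP: e; rewrite c0 subr0 sqrf_eq1 => /orP[]/eqP a1.
    apply/imsetP; exists X; first by rewrite in_setD1 nX.
    by rewrite eA /affine a1 scale1r.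
  apply/imsetP; exists (- X); first by rewrite in_setD1 oppr_eq0 nX quadric_opp.
  rewrite -(SolM_opp (det_unip (quadric_opp qX))); congr SolM.
  by rewrite eA /affine a1 scale1r opprB addrC raddfN.
have [b nb [cb|cb]] := sqr_or_opp nc.
  have qM : b^-1 *: X \in quadric 1.
    apply/quadricP; rewrite linearZ /= tX mulr0 detZ (quadric_det qX) cb; split=> //.
    by field.
  have eAb : A = affine a b (b^-1 *: X).
    by rewrite {1}eA /affine scalerA divff.
  have na : a != 0.
    apply/eqP=> a0; case/negP: (nsqN1 b); rewrite -cb -e a0 expr0n sub0r.
    by rewrite opprK.
  have uab : a ^+ 2 - b ^+ 2 * 1 = 1 by rewrite mulr1 -cb.
  apply/orP; left; apply/orP; right; apply/imsetP; exists (b^-1 *: X) => //.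
  by rewrite {1}eAb; apply: (SolM_regular_eq char3 nsqN1 (oner_neq0 F)).
have qM : b^-1 *: X \in quadric (-1).
  apply/quadricP; rewrite linearZ /= tX mulr0 detZ (quadric_det qX) cb; split=> //.
  by field.
have eAb : A = affine a b (b^-1 *: X).
  by rewrite {1}eA /affine scalerA divff.
have uab : a ^+ 2 - b ^+ 2 * -1 = 1 by rewrite mulrN1 -cb.
do 2![apply/orP; left]; have [a0|na] := eqVneq a 0; apply/orP; [left | right].
  apply/orP; right; apply/imsetP; exists A => //; apply/quadricP.
  by rewrite dA opprK {1}eA /affine a0 raddf0 add0r scale1r.
apply/imsetP; exists (b^-1 *: X) => //.
by rewrite {1}eAb; apply: (SolM_regular_eq char3 nsqN1 nN1).
Qed.

Lemma Solv_families : Solv (SL2 F) =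
  [set SolM (1 : 'M[F]_2)] :|: inv_family :|: nonsplit_family
    :|: split_family :|: unip_family.
Proof.
have sub A : \det A = 1 -> SolM A \in Solv (SL2 F).
  by move=> dA; apply: imset_f; apply: gl_SL2.
apply/eqP; rewrite eqEsubset; apply/andP; split.
  apply/subsetP=> _ /imsetP[x Gx ->]; rewrite -(gl_val x).
  exact: (SolM_cases (SL2_det Gx)).
rewrite !subUset sub1set sub ?det1 //=.
do ![apply/andP; split]; apply/subsetP=> _ /imsetP[M qM ->]; apply: sub.
- exact: det_inv.
- exact: (det_regular unimod2).
- exact: (det_regular unimod3).
- by apply: det_unip; case/setD1P: qM.
Qed.

Lemma card_inv_family : (#|inv_family| * 2 = #|F| * #|F|.-1)%N.
Proof.
rewrite (card_imset_opp char3).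
- rewrite card_quadric (_ : [set u | _] = set0) ?cards0 ?mul0n ?addn0 //.
  by apply/setP=> u; rewrite !inE (negPf (nsqN1 u)).
- by apply/negP=> /(quadric_neq0 nN1); rewrite eqxx.
- exact: quadric_opp.
- by move=> M /det_inv; apply: SolM_opp.
- exact: (SolM_inv_inj char3 nsqN1 nal3 nbe3 unimod3).
Qed.

Lemma card_nonsplit_family : (#|nonsplit_family| * 2 = #|F| * #|F|.-1)%N.
Proof.
rewrite (card_imset_opp char3).
- rewrite card_quadric (_ : [set u | _] = set0) ?cards0 ?mul0n ?addn0 //.
  by apply/setP=> u; rewrite !inE (negPf (nsqN1 u)).
- by apply/negP=> /(quadric_neq0 nN1); rewrite eqxx.
- exact: quadric_opp.
- exact: (SolM_regular_opp char3 nsqN1 nN1 nal2 nbe2 unimod2).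
- exact: (SolM_nonsplit_inj char3 nsqN1 nal2 nbe2 unimod2).
Qed.

Lemma card_split_family : (#|split_family| * 2 = #|F| * #|F|.-1 + 2 * #|F|)%N.
Proof.
rewrite (card_imset_opp char3).
- rewrite card_quadric (_ : [set u | _] = [set 1; -1]) ?cards2.
    suff -> : 1 != -1 :> F by [].
    by rewrite -addr_eq0 (addrr_eq0 char3) oner_neq0.
  by apply/setP=> u; rewrite !inE sqrf_eq1.
- by apply/negP=> /(quadric_neq0 (oner_neq0 F)); rewrite eqxx.
- exact: quadric_opp.
- exact: (SolM_regular_opp char3 nsqN1 (oner_neq0 F) nal3 nbe3 unimod3).
- exact: (SolM_split_inj char3 nsqN1 nal3 nbe3 unimod3).
Qed.

Lemma card_unip_family : (#|unip_family| * 2 + 1 = #|F| * #|F|.-1 + #|F|)%N.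
Proof.
have q0 : (0 : 'M[F]_2) \in quadric 0.
  by apply/quadricP; rewrite raddf0 det0 oppr0.
rewrite (card_imset_opp char3).
- have := cardsD1 0 (quadric (0 : F)); rewrite q0 addnC => <-.
  rewrite card_quadric (_ : [set u | _] = [set 0]) ?cards1 ?mul1n //.
  by apply/setP=> u; rewrite !inE expf_eq0.
- by rewrite in_setD1 eqxx.
- by move=> M /setD1P[nM qM]; rewrite in_setD1 oppr_eq0 nM quadric_opp.
- by move=> M /setD1P[nM qM]; apply: SolM_unip_opp.
- move=> M N /setD1P[nM qM] /setD1P[nN qN].
  exact: (SolM_unip_inj char3 nsqN1 nal3 nbe3 unimod3).
Qed.

Lemma card_Solv_SL2 : (#|Solv (SL2 F)| * 2 = 4 * #|F| ^ 2 - #|F| + 1)%N.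
Proof.
have disj (T : finType) (A B : {set T}) :
    (forall x y, x \in A -> y \in B -> x <> y) -> #|A :|: B| = (#|A| + #|B|)%N.
  move=> H; rewrite cardsU (_ : A :&: B = set0) ?cards0 ?subn0 //.
  by apply/setP=> x; rewrite !inE; apply/negP=> /andP[Ax Bx]; apply: (H x x).
rewrite Solv_families !disj.
- have := card_inv_family; have := card_nonsplit_family.
  have := card_split_family; have := card_unip_family; rewrite cards1.
  have : (0 < #|F|)%N by apply/card_gt0P; exists 0.
  case: #|F| => // k _ /=; move: #|inv_family| #|nonsplit_family|.
  by move: #|split_family| #|unip_family| => s u i ns; nia.
- move=> _ _ /set1P-> /imsetP[M qM ->].
  exact: (one_neq_inv char3 nsqN1 nal3 nbe3 unimod3).
- move=> x _ /setUP[/set1P->|/imsetP[N qN ->]] /imsetP[M qM ->].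
    exact: (one_neq_nonsplit char3 nsqN1 nal2 nbe2 nal3 nbe3 unimod2 unimod3).
  exact: (inv_neq_nonsplit char3 nsqN1 nal2 nbe2 nal3 nbe3 unimod2 unimod3).
- move=> x _ /setUP[/setUP[/set1P->|/imsetP[N qN ->]]|/imsetP[N qN ->]] /imsetP[M qM ->].
  + exact: (one_neq_split char3 nsqN1 nal3 nbe3 unimod3).
  + exact: (inv_neq_split char3 nsqN1 nal3 nbe3 unimod3).
  + apply/nesym.
    exact: (split_neq_nonsplit char3 nsqN1 nal2 nbe2 nal3 nbe3 unimod2 unimod3).
- move=> x _ Hx /imsetP[M /setD1P[nM qM] ->]; move: Hx.
  case/setUP=> [/setUP[/setUP[/set1P->|/imsetP[N qN ->]]|/imsetP[N qN ->]]
               |/imsetP[N qN ->]].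
  + exact: (one_neq_unip char3 nsqN1 nal3 nbe3 unimod3).
  + exact: (inv_neq_unip char3 nsqN1 nal3 nbe3 unimod3).
  + apply/nesym.
    exact: (unip_neq_nonsplit char3 nsqN1 nal2 nbe2 nal3 nbe3 unimod2 unimod3).
  + apply/nesym.
    exact: (unip_neq_split char3 nsqN1 nal3 nbe3 unimod3).
Qed.

End CardSolv.

(** * Arithmetic of the field of order 3^n, n odd *)

Section FieldOfOrder3Odd.
Local Open Scope ring_scope.
Variables (F : finFieldType) (n : nat).
Hypotheses (oddn : odd n) (n3 : (3 <= n)%N) (cardF : #|F| = (3 ^ n)%N).

Lemma order_char3 : 3%:R = 0 :> F.
Proof. by have /andP[_ /eqP] := card_finPcharP cardF isT. Qed.

(** For odd [n], [3 ^ n] is 3 times a power of 9, and 9 is 1 modulo 4. *)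
Lemma order_mod4 : exists k, #|F| = (4 * k + 3)%N.
Proof.
rewrite cardF -(odd_double_half n) oddn add1n expnS -mul2n expnM -[(3 ^ 2)%N]/(9)%N.
elim: n./2 => [|m [k IH]]; first by exists 0%N.
by exists (9 * k + 6)%N; rewrite expnS mulnCA IH; lia.
Qed.

(** If [a ^+ 2 = -1], then [a = a ^+ (4 k + 3) = a ^+ 3 = - a]. *)
Lemma order_nsqN1 (a : F) : a ^+ 2 != -1.
Proof.
have [k ek] := order_mod4; apply/eqP=> a2.
have a0 : a = 0.
  have := expf_card a; rewrite ek exprD exprM -[4%N]/(2 * 2)%N exprM a2 sqrrN.
  rewrite !expr1n mul1r exprS a2 mulrN1 => /eqP; rewrite -subr_eq0 -opprD oppr_eq0.
  by rewrite (addrr_eq0 order_char3) => /eqP.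
by move/eqP: a2; rewrite a0 expr0n eq_sym oppr_eq0 oner_eq0.
Qed.

Lemma order_sqr_or_opp (c : F) : c != 0 ->
  exists2 b, b != 0 & c = b ^+ 2 \/ c = - b ^+ 2.
Proof.
(* The witness is [c] to the power (q + 1)/4; its square is [c] times the power (q - 1)/2 of [c],
   which is 1 or -1. *)
move=> nc; have [k ek] := order_mod4; exists (c ^+ k.+1); first exact: expf_neq0.
have : (c ^+ (k.*2.+1)) ^+ 2 = 1.
  apply: (mulfI nc); rewrite mulr1 -{3}(expf_card c) -exprM -exprS; congr (_ ^+ _).
  by rewrite ek; lia.
have -> : (c ^+ k.+1) ^+ 2 = c * c ^+ (k.*2.+1).
  by rewrite -exprM muln2 doubleS exprS.
move/eqP; rewrite sqrf_eq1 => /orP[]/eqP->.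
  by left; rewrite mulr1.
by right; rewrite mulrN1 opprK.
Qed.

Lemma order_generic_elt : exists d : F, [/\ d != 0, d ^+ 2 != 1 & d ^+ 2 != -1].
Proof.
pose S : seq F := [:: 0; 1; -1].
have [d Sd] : exists d, d \notin S.
  apply/existsP; apply: contraT => /existsPn allS.
  have: (#|[set: F]| <= #|S|)%N.
    by apply/subset_leq_card/subsetP=> d _; apply: contraNT (allS d).
  rewrite cardsT cardF leqNgt => /negP[]; apply: leq_ltn_trans (card_size S) _.
  by rewrite (@ltn_exp2l 3 1 n) //; lia.
exists d; move: Sd; rewrite !inE !negb_or => /and3P[d0 d1 dN1].
by rewrite d0 sqrf_eq1 negb_or d1 dN1 order_nsqN1.
Qed.

Lemma order_card_Solv : (#|Solv (SL2 F)| * 2 = 4 * #|F| ^ 2 - #|F| + 1)%N.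
Proof.
have char3 := order_char3; have h2 := two_neq0 char3.
have [d [nd d1 dN1]] := order_generic_elt.
have nD : 1 + d ^+ 2 != 0 by rewrite addrC addr_eq0.
(* Rational points of [a ^+ 2 + b ^+ 2 = 1] and [a ^+ 2 - b ^+ 2 = 1]; the conditions on [d] keep
   coordinates and denominators nonzero. *)
apply: (card_Solv_SL2 char3 order_nsqN1 order_sqr_or_opp
  (al2 := (1 - d ^+ 2) / (1 + d ^+ 2)) (be2 := 2%:R * d / (1 + d ^+ 2))
  (al3 := (d + d^-1) / 2%:R) (be3 := (d - d^-1) / 2%:R)).
- by rewrite mulf_neq0 ?invr_eq0 // subr_eq0 eq_sym.
- by rewrite !mulf_neq0 ?invr_eq0.
- rewrite mulf_neq0 ?invr_eq0 //; apply: contraNneq dN1 => e.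
  by rewrite -addr_eq0 -(mulfV nd) expr2 -mulrDr e mulr0.
- rewrite mulf_neq0 ?invr_eq0 //; apply: contraNneq d1 => e.
  by rewrite -subr_eq0 -(mulfV nd) expr2 -mulrBr e mulr0.
- by field.
- by field; rewrite nd h2.
Qed.

End FieldOfOrder3Odd.

Theorem theorem4p3 (F : finFieldType) (n : nat) :
  odd n -> 3 <= n -> #|F| = 3 ^ n ->
  #|Solv (PSL2 F)| = (4 * (3 ^ n) ^ 2 - 3 ^ n + 1) %/ 2.
Proof.
(* The centre is solvable, so the count descends from SL(2, q); its doubled form makes the division
   by 2 exact. *)
move=> oddn n3 cardF; rewrite (card_Solv_quotient (center_normal _)); last first.
  exact/abelian_sol/center_abelian.
by rewrite -cardF -(order_card_Solv oddn n3 cardF) mulnK.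
Qed.
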